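(* For an integer $m\ge2$, let $\mathrm{F}(m)$ denote the following assertion: for every non-empty collection $E\subset A(m,1)$ of non-vertical lines such that $B=\bigcup_{P\in E}P\subset\mathbb{R}^m$ is Borel, we have $\dim B=\beta+1$, where $\beta=\mathrm{ess}^{1}\text{-}\sup(\dim B_t)$. Then: (i) For any $m\ge2$, if $\mathrm{F}(m)$ holds, then every Besicovitch set in $\mathbb{R}^m$ has Hausdorff dimension at least $m-1$. (ii) If $\mathrm{F}(m)$ holds for every $m\ge2$, then for every $m\ge 2$ every Besicovitch set in $\mathbb{R}^m$ has upper Minkowski dimension $m$.
   Context: $\dim$ denotes Hausdorff dimension. $A(m,1)$ is the set of all lines (1-dimensional affine subspaces) of $\mathbb{R}^m$. Write $\mathbb{R}^m=\mathbb{R}\times\mathbb{R}^{m-1}$; a line is non-vertical if its orthogonal projection to the first coordinate axis $\mathbb{R}\times\{0\}$ is the whole axis. For $t\in\mathbb{R}$, $B_t=\{x\in\mathbb{R}^{m-1}:(t,x)\in B\}$, and $\mathrm{ess}^{1}\text{-}\sup(\dim B_t)=\sup\{q\ge0:\mathcal{H}^1(\{t\in\mathbb{R}:\dim B_t>q\})>0\}$ with $\sup\emptyset=0$, where $\mathcal{H}^1$ is 1-dimensional Hausdorff measure. A Besicovitch set in $\mathbb{R}^m$ is a subset of $\mathbb{R}^m$ that contains a unit line segment in every direction. *)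

(* Defs.v *)
From mathcomp Require Import all_boot all_order all_algebra.
From mathcomp Require Import all_classical all_reals all_analysis.

Set Implicit Arguments.
Unset Strict Implicit.
Unset Printing Implicit Defensive.

Import Order.TTheory GRing.Theory Num.Theory.
Import numFieldNormedType.Exports.

Local Open Scope classical_set_scope.
Local Open Scope ring_scope.

(* The norm that MathComp-Analysis puts on 'rV[R]_n is the sup norm; metric
   notions on R^n are therefore stated for the Euclidean distance below. *)
Definition enorm (R : realType) (n : nat) (x : 'rV[R]_n) : R :=
  Num.sqrt (\sum_(i < n) x 0 i ^+ 2).

Definition euclidean_dist (R : realType) (n : nat) (x y : 'rV[R]_n) : R :=
  enorm (x - y).

Definition rdist (R : realType) (x y : R) : R := `|x - y|.

(* In what follows [d] is the distance of the ambient metric space [T]. *)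

Definition diam (R : realType) (T : Type) (d : T -> T -> R) (U : set T)
    : \bar R :=
  ereal_sup [set (d p.1 p.2)%:E | p in U `*` U].

(* [diam d U ^ s] with [0 ^ 0 = 1], except that the empty set has weight 0
   for every s; H^0 is then the counting measure. *)
Definition hausdorff_weight (R : realType) (T : Type) (d : T -> T -> R)
    (s : R) (U : set T) : \bar R :=
  if `[< U = set0 >] then 0%E else poweR (diam d U) s.

Definition hausdorff_content (R : realType) (T : Type) (d : T -> T -> R)
    (s delta : R) (A : set T) : \bar R :=
  ereal_inf [set (\sum_(0 <= i <oo) hausdorff_weight d s (U i))%E |
    U in [set U : nat -> set T |
      (forall i, (diam d (U i) <= delta%:E)%E) /\ A `<=` \bigcup_i U i]].

Definition hausdorff_measure (R : realType) (T : Type) (d : T -> T -> R)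
    (s : R) (A : set T) : \bar R :=
  ereal_sup [set hausdorff_content d s delta A |
    delta in [set delta : R | 0 < delta]].

Definition hausdorff_dim (R : realType) (T : Type) (d : T -> T -> R)
    (A : set T) : \bar R :=
  ereal_inf [set s%:E |
    s in [set s : R | 0 <= s /\ hausdorff_measure d s A = 0%E]].

Definition covering_number (R : realType) (T : Type) (d : T -> T -> R)
    (delta : R) (A : set T) : \bar R :=
  ereal_inf [set (k%:R)%:E | k in [set k : nat |
    exists U : 'I_k -> set T,
      (forall i, (diam d (U i) <= delta%:E)%E) /\
      A `<=` \bigcup_(i in [set: 'I_k]) U i]].

(* limsup of log N(A, delta) / (- log delta) as delta -> 0+; this is the
   upper Minkowski dimension of a bounded set A. *)
Definition upper_box_dim (R : realType) (T : Type) (d : T -> T -> R)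
    (A : set T) : \bar R :=
  limf_esup (fun delta : R =>
    (lne (covering_number d delta A) * ((- ln delta)^-1)%:E)%E) (0 : R)^'+.

(* An unbounded subset of R^n has infinite covering numbers; its upper Minkowski
   dimension is taken to be the supremum over its bounded subsets. By
   monotonicity this is [upper_box_dim d A] when A itself is bounded. *)
Definition upper_minkowski_dim (R : realType) (T : Type) (d : T -> T -> R)
    (A : set T) : \bar R :=
  ereal_sup [set upper_box_dim d A' |
    A' in [set A' : set T | A' `<=` A /\ (diam d A' < +oo)%E]].

Definition is_borel (T : topologicalType) (B : set T) : Prop :=
  <<s [set U : set T | open U] >> B.

Definition is_line (R : realType) (m : nat) (P : set 'rV[R]_m) : Prop :=
  exists (a v : 'rV[R]_m), v != 0 /\ P = [set a + s *: v | s in [set: R]].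

(* R^m is 'rV[R]_n.+1 with m = n + 1; column 0 is the distinguished first
   coordinate of R * R^n. *)
Definition non_vertical (R : realType) (n : nat) (P : set 'rV[R]_n.+1) : Prop :=
  [set x 0 ord0 | x in P] = [set: R].

Definition slice (R : realType) (n : nat) (B : set 'rV[R]_n.+1) (t : R)
    : set 'rV[R]_n :=
  [set x : 'rV[R]_n | B (row_mx (t%:M : 'rV[R]_1) x)].

(* The element 0 encodes the convention sup(empty set) = 0. *)
Definition ess_sup_slice_dim (R : realType) (n : nat) (B : set 'rV[R]_n.+1)
    : \bar R :=
  ereal_sup (0%E |` [set q%:E | q in [set q : R | 0 <= q /\
    (0 < hausdorff_measure (@rdist R) 1%R
           [set t : R | q%:E < hausdorff_dim (@euclidean_dist R n) (slice B t)])%E]]).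

(* The assertion F(m) for m = n + 1. *)
Definition fubini_for_lines (R : realType) (n : nat) : Prop :=
  forall E : set (set 'rV[R]_n.+1),
    E !=set0 ->
    (forall P, E P -> is_line P /\ non_vertical P) ->
    let B := \bigcup_(P in E) P in
    is_borel B ->
    hausdorff_dim (@euclidean_dist R n.+1) B = (ess_sup_slice_dim B + 1)%E.

Definition besicovitch (R : realType) (m : nat) (B : set 'rV[R]_m) : Prop :=
  forall e : 'rV[R]_m, enorm e = 1 ->
    exists a : 'rV[R]_m, forall s : R, 0 <= s <= 1 -> B (a + s *: e).

(* Main.v *)
(* Idea. Let B be a Besicovitch set with H^s(B) = 0. The union S of countably
   many dilated, translated and projectively transformed copies of B, the
   projective map being (x, y) |-> (1/x, y/x), is still H^s-null, and for each v
   and k the set of those a for which S contains the points (t, v + t a) with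
   1/k <= |t| <= k is dense. Covering S by open sets with small sums, a nested
   compactness argument yields a compact set K of pairs (a, v) that projects onto
   the unit cube of the v's and whose lines {(t, v + t a)} minus {t = 0} form an
   H^s-null set. The union of these lines has the unit cube as its slice at t = 0,
   hence has dimension at least m - 1, while almost all of its slices have
   dimension at most s - 1; F(m) then forces s >= m - 1.
   For the second part, the power B^k is a Besicovitch set in R^(mk), and its
   Hausdorff dimension is at most k times the upper Minkowski dimension of B;
   divide mk - 1 by k and let k tend to infinity. *)
Require Import Defs.
From mathcomp Require Import all_boot all_order all_algebra.
From mathcomp Require Import all_classical all_reals all_analysis.
From mathcomp Require Import measurable_realfun ring lra zify.

Set Implicit Arguments.
Unset Strict Implicit.
Unset Printing Implicit Defensive.

Import Order.TTheory GRing.Theory Num.Theory.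
Import numFieldNormedType.Exports.
Local Open Scope classical_set_scope.
Local Open Scope ring_scope.

(** * Null sets of Hausdorff measures *)

(* For s > 0 this amounts to H^s(A) = 0: the bound on the sum forces the radii
   to be small. *)
Definition null_cover (R : realType) (T : Type) (d : T -> T -> R) (s : R)
    (A : set T) : Prop :=
  forall e : R, 0 < e -> exists (U : nat -> set T) (r : nat -> R),
    [/\ forall i, 0 < r i,
        forall i x y, U i x -> U i y -> d x y <= r i,
        A `<=` \bigcup_i U i &
        (\sum_(i <oo) (r i `^ s)%:E <= e%:E)%E].

Section null_cover_theory.
Context {R : realType}.
Implicit Types s e : R.

Lemma powR_invK (a s : R) : 0 <= a -> s != 0 -> (a `^ s^-1) `^ s = a.
Proof. by move=> a0 s0; rewrite -powRrM mulVf// powRr1. Qed.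

Lemma powR_le_base (a b s : R) : 0 < s -> 0 <= a -> 0 <= b ->
  a `^ s <= b `^ s -> a <= b.
Proof.
move=> s0 a0 b0 h; rewrite leNgt; apply/negP => ba.
by have := gt0_ltr_powR s0 b0 a0 ba; rewrite ltNge h.
Qed.

Lemma nneseries_term_le (f : nat -> R) e i : (forall j, 0 <= f j) ->
  (\sum_(j <oo) (f j)%:E <= e%:E)%E -> f i <= e.
Proof.
move=> f0 fe; rewrite -lee_fin; apply: le_trans fe.
apply: le_trans (nneseries_lim_ge i.+1 _); last by move=> j _ _; rewrite lee_fin.
rewrite big_mkord big_ord_recr/= leeDr// sume_ge0// => j _.
by rewrite lee_fin.
Qed.

Lemma powR_sum_scale (r : nat -> R) s c e : 0 < s -> 0 < c ->
  (forall i, 0 <= r i) ->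
  (\sum_(i <oo) (r i `^ s)%:E <= (e / c `^ s)%:E)%E ->
  (\sum_(i <oo) ((c * r i) `^ s)%:E <= e%:E)%E.
Proof.
move=> s0 c0 r0 h.
have cs0 : 0 < c `^ s by exact: powR_gt0.
under eq_eseriesr do rewrite powRM ?(ltW c0)// EFinM.
rewrite nneseriesZl; last by move=> i _; rewrite lee_fin powR_ge0.
apply: (@le_trans _ _ ((c `^ s)%:E * (e / c `^ s)%:E)%E).
  by rewrite lee_pmul2l// lte_fin.
by rewrite -EFinM lee_fin mulrC divfK// gt_eqF.
Qed.

Section metric.
Variables (T : Type) (d : T -> T -> R).

Lemma null_coverS s A B : A `<=` B -> null_cover d s B -> null_cover d s A.
Proof.
move=> AB nB e e0; have [U [r [r0 Ur BU rs]]] := nB e e0.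
by exists U, r; split => //; exact: subset_trans BU.
Qed.

Lemma diam_le (U : set T) (r : R) :
  (forall x y, U x -> U y -> d x y <= r) -> (diam d U <= r%:E)%E.
Proof.
move=> Ur; apply: ge_ereal_sup => _ [[x y]/= [Ux Uy] <-].
by rewrite lee_fin; exact: Ur.
Qed.

Lemma le_diam (U : set T) x y : U x -> U y -> ((d x y)%:E <= diam d U)%E.
Proof. by move=> Ux Uy; apply: ereal_sup_ubound; exists (x, y). Qed.

Hypothesis d_ge0 : forall x y, 0 <= d x y.

Lemma hausdorff_weight_ge0 s (U : set T) : (0 <= hausdorff_weight d s U)%E.
Proof. by rewrite /hausdorff_weight; case: ifP => // _; exact: poweR_ge0. Qed.

Lemma hausdorff_weight_le s (U : set T) (r : R) : 0 <= s -> 0 <= r ->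
  (forall x y, U x -> U y -> d x y <= r) ->
  (hausdorff_weight d s U <= (r `^ s)%:E)%E.
Proof.
move=> s0 r0 Ur; rewrite /hausdorff_weight; case: asboolP => [_|/eqP/set0P[x Ux]].
  by rewrite lee_fin powR_ge0.
have D0 : (0 <= diam d U)%E.
  by apply: le_trans (le_diam Ux Ux); rewrite lee_fin.
have Dr := diam_le Ur.
rewrite -poweR_EFin; apply: gt0_ler_poweR => //.
  by rewrite in_itv/= D0 leey.
by rewrite in_itv/= lee_fin r0 leey.
Qed.

(** As the diameter is at most 1, raising the exponent from [s0] to [s] only lowers the weight; the
    slack [eta] pays for a positive radius when the diameter is 0 or the set is empty. *)
Lemma exists_radius_weight s0 s (U : set T) (eta : R) :
  0 <= s0 <= s -> 0 < s -> 0 < eta -> (diam d U <= 1%:E)%E ->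
  exists r : R, [/\ 0 < r, forall x y, U x -> U y -> d x y <= r &
    ((r `^ s)%:E <= hausdorff_weight d s0 U + eta%:E)%E].
Proof.
move=> /andP[s00 s0s] s_gt0 eta0 DU.
rewrite /hausdorff_weight; case: asboolP => [->|/eqP/set0P[x0 Ux]].
  exists (eta `^ s^-1); split => //; first exact: powR_gt0.
  by rewrite add0e powR_invK ?(ltW eta0) ?gt_eqF.
have [D DE] : exists D : R, diam d U = D%:E.
  have := le_diam Ux Ux; move: DU; case: (diam d U) => // D _ _.
  by exists D.
rewrite DE in DU *.
have Ud x y : U x -> U y -> d x y <= D.
  by move=> ? ?; rewrite -lee_fin -DE; exact: le_diam.
have D0 : 0 <= D by exact: le_trans (Ud _ _ Ux Ux).
rewrite lee_fin in DU.
have p0 : 0 < D `^ s + eta by rewrite ltr_wpDl// powR_ge0.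
exists ((D `^ s + eta) `^ s^-1); split.
- exact: powR_gt0.
- move=> x y Ux' Uy; apply: le_trans (Ud _ _ Ux' Uy) _.
  apply: (@powR_le_base _ _ s) => //; first exact: powR_ge0.
  by rewrite powR_invK ?(ltW p0) ?gt_eqF// lerDl ltW.
- rewrite powR_invK ?(ltW p0) ?gt_eqF// EFinD leeD2r// poweR_EFin lee_fin.
  have [->|Dn0] := eqVneq D 0.
    by rewrite powR0 ?gt_eqF// powR_ge0.
  by apply: ger_powR => //; rewrite lt_def Dn0 D0.
Qed.

(** The exponent [s0] may be 0, hence a separate positive target [s]. Half of [e] bounds the content
    at scale 1, the other half is spread geometrically over the radii. *)
Lemma null_cover_of_hausdorff s0 s A : 0 <= s0 <= s -> 0 < s ->
  hausdorff_measure d s0 A = 0%E -> null_cover d s A.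
Proof.
move=> s0s s_gt0 HA e e0.
have : (hausdorff_content d s0 1 A < (e / 2)%:E)%E.
  apply: (@le_lt_trans _ _ 0%E); last by rewrite lte_fin divr_gt0.
  by rewrite -HA; apply: ereal_sup_ubound; exists 1 => /=.
move/ereal_inf_lt => [_ [U [DU AU] <-]] Ue.
have /choice[r rP] : forall i, exists r : R,
    [/\ 0 < r, forall x y, U i x -> U i y -> d x y <= r &
    ((r `^ s)%:E <= hausdorff_weight d s0 (U i) + ((e / 2) / (2 ^ i.+1)%:R)%:E)%E].
  move=> i; apply: exists_radius_weight => //.
  by rewrite !divr_gt0// ltr0n expn_gt0.
exists U, r; split => //.
- by move=> i; have [] := rP i.
- by move=> i; have [] := rP i.
- apply: (@le_trans _ _ (\sum_(i <oo) (hausdorff_weight d s0 (U i)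
     + ((e / 2) / (2 ^ i.+1)%:R)%:E))%E).
    apply: lee_nneseries => i; first by move=> _ _; rewrite lee_fin powR_ge0.
    by move=> _; have [] := rP i.
  apply: le_trans (epsilon_trick _ _ _) _.
  + by move=> i; exact: hausdorff_weight_ge0.
  + by rewrite divr_ge0// ltW.
  rewrite [leRHS](_ : _ = (e/2)%:E + (e/2)%:E)%E; last by rewrite -EFinD -splitr.
  by rewrite leeD2r// ltW.
Qed.

Lemma hausdorff_of_null_cover s A : 0 < s ->
  null_cover d s A -> hausdorff_measure d s A = 0%E.
Proof.
move=> s0 nA.
have H0 delta : (0 <= hausdorff_content d s delta A)%E.
  apply: le_ereal_inf_tmp => _ [U _ <-].
  by apply: nneseries_ge0 => i _ _; exact: hausdorff_weight_ge0.
apply/eqP; rewrite eq_le; apply/andP; split; last first.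
  apply: le_trans (H0 1) _; apply: ereal_sup_ubound; exists 1 => //=.
apply: ge_ereal_sup => _ [delta /= delta0 <-].
apply/lee_addgt0Pr => e e0; rewrite add0e.
(* A bound on the whole sum by the [s]-th power of [delta] bounds each term, so every radius is at
   most [delta] and the cover is admissible at that scale. *)
have e'0 : 0 < Num.min e (delta `^ s) by rewrite lt_min e0 powR_gt0.
have [U [r [r0 Ur AU rs]]] := nA _ e'0.
apply: ge_ereal_inf; exists (\sum_(0 <= i <oo) hausdorff_weight d s (U i))%E.
  exists U => //; split => // i; apply: diam_le => x y Ux Uy.
  apply: le_trans (Ur i _ _ Ux Uy) _.
  apply: (powR_le_base s0 (ltW (r0 i)) (ltW delta0)) => //.
  have := nneseries_term_le i (fun j => powR_ge0 _ _) rs.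
  by rewrite le_min => /andP[].
apply: (@le_trans _ _ (\sum_(i <oo) (r i `^ s)%:E)%E).
  apply: lee_nneseries => i _; first by move=> _; exact: hausdorff_weight_ge0.
  by apply: hausdorff_weight_le; [exact: ltW|exact: ltW|exact: Ur].
by apply: le_trans rs _; rewrite lee_fin ge_min lexx.
Qed.

Lemma hausdorff_dim_le_null_cover s A : 0 < s ->
  null_cover d s A -> (hausdorff_dim d A <= s%:E)%E.
Proof.
move=> s0 nA; apply: ereal_inf_lbound; exists s => //; split; first exact: ltW.
exact: hausdorff_of_null_cover.
Qed.

Lemma null_cover_of_dim_lt s A : 0 < s ->
  (hausdorff_dim d A < s%:E)%E -> null_cover d s A.
Proof.
move=> s0 /ereal_inf_lt[_ [t [t0 HA] <-]]; rewrite lte_fin => ts.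
by apply: null_cover_of_hausdorff HA => //; rewrite t0 ltW.
Qed.

Lemma null_cover_bigcup s (A : nat -> set T) : 0 < s ->
  (forall j, null_cover d s (A j)) -> null_cover d s (\bigcup_j A j).
Proof.
move=> s0 nA e e0.
have /choice[U /choice[r UrP]] : forall j, exists (U : nat -> set T)
    (r : nat -> R), [/\ forall i, 0 < r i,
        forall i x y, U i x -> U i y -> d x y <= r i,
        A j `<=` \bigcup_i U i &
        (\sum_(i <oo) (r i `^ s)%:E <= (e / (2 ^ j.+1)%:R)%:E)%E].
  by move=> j; apply: nA; rewrite divr_gt0// ltr0n expn_gt0.
have /ppcard_eqP[/= f] : ([set: nat] #= [set: nat * nat])%card.
  by rewrite card_eq_sym; exact: card_nat2.
have fb : set_bij setT setT f by exact: 'bij_f.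
exists (fun k => U (f k).1 (f k).2), (fun k => r (f k).1 (f k).2); split.
- by move=> k; have [+ _ _ _] := UrP (f k).1; exact.
- by move=> k; have [_ + _ _] := UrP (f k).1; exact.
- move=> x [j _ Ajx]; have [_ _ /(_ x Ajx) [i _ Ux] _] := UrP j.
  have [k _ fk] : (f @` setT) (j, i) by case: fb => _ _; apply.
  by exists k => //=; rewrite fk.
- rewrite nneseries_esumT; last by move=> k; rewrite lee_fin powR_ge0.
  pose a (p : nat * nat) := ((r p.1 p.2) `^ s)%:E.
  rewrite -(@reindex_esum _ _ _ setT setT f a fb).
  rewrite [X in (\esum_(i in X) _ <= _)%E](_ : _ = setT `*`` (fun=> setT)); last first.
    by apply/seteqP; split => // -[].
  rewrite -(esum_esum (a := fun j i => a (j, i)));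
    last by move=> *; rewrite lee_fin powR_ge0.
  rewrite -nneseries_esumT; last first.
    by move=> j; apply: esum_ge0 => i _; rewrite lee_fin powR_ge0.
  apply: le_trans (epsilon_trick0 xpredT (ltW e0)).
  apply: lee_nneseries.
    by move=> j _ _; apply: esum_ge0 => i _; rewrite lee_fin powR_ge0.
  move=> j _; have [_ _ _] := UrP j; rewrite nneseries_esumT//.
  by move=> i; rewrite lee_fin powR_ge0.
Qed.

End metric.

Lemma null_cover_lipschitz (T1 T2 : Type) (d1 : T1 -> T1 -> R)
    (d2 : T2 -> T2 -> R) (f : T1 -> T2) (c s : R) (A : set T1) :
  0 < s -> 0 < c ->
  (forall x y, A x -> A y -> d2 (f x) (f y) <= c * d1 x y) ->
  null_cover d1 s A -> null_cover d2 s (f @` A).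
Proof.
move=> s0 c0 fc nA e e0.
have e'0 : 0 < e / c `^ s by rewrite divr_gt0// powR_gt0.
have [U [r [r0 Ur AU rs]]] := nA _ e'0.
exists (fun i => f @` (U i `&` A)), (fun i => c * r i); split.
- by move=> i; rewrite mulr_gt0.
- move=> i _ _ [x [Ux Ax] <-] [y [Uy Ay] <-].
  apply: le_trans (fc _ _ Ax Ay) _.
  by rewrite ler_pM2l//; exact: Ur Uy.
- by move=> _ [x Ax <-]; have [i _ Ux] := AU _ Ax; exists i => //; exists x.
- by apply: powR_sum_scale => // i; exact: ltW.
Qed.

Definition norm_dist (V : normedModType R) (x y : V) : R := `|x - y|.

(** Replacing each covering set by its neighbourhood of radius [r i] makes it open and at most
    triples the diameter. *)
Lemma null_cover_open (V : normedModType R) s (A : set V) (e : R) :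
  0 < s -> 0 < e -> null_cover (@norm_dist V) s A ->
  exists (U : nat -> set V) (r : nat -> R),
    [/\ forall i, 0 < r i,
        forall i x y, U i x -> U i y -> `|x - y| <= r i,
        A `<=` \bigcup_i U i,
        (\sum_(i <oo) (r i `^ s)%:E <= e%:E)%E &
        forall i, open (U i)].
Proof.
move=> s0 e0 nA.
have e'0 : 0 < e / 3 `^ s by rewrite divr_gt0// powR_gt0.
have [U [r [r0 Ur AU rs]]] := nA _ e'0.
exists (fun i => \bigcup_(x in U i) ball x (r i)), (fun i => 3 * r i); split.
- by move=> i; rewrite mulr_gt0.
- move=> i x y [x' Ux xx'] [y' Uy yy'].
  move: xx' yy'; rewrite -!ball_normE/= => xx' yy'.
  have := Ur i _ _ Ux Uy; rewrite /norm_dist => x'y'.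
  rewrite (_ : x - y = (x' - y') + ((y' - y) - (x' - x))); last first.
    by rewrite opprB addrA subrKA addrC subrKA.
  apply: le_trans (ler_normD _ _) _.
  apply: le_trans (lerD x'y' (ler_normB _ _)) _; lra.
- move=> x /AU[i _ Ux]; exists i => //; exists x => //; exact: ballxx.
- by apply: powR_sum_scale => // i; exact: ltW.
- by move=> i; apply: bigcup_open => x _; exact: ball_open.
Qed.

End null_cover_theory.

(** * Comparison of the sup norm with the Euclidean norm *)

Lemma rv_norm_leP (R : realType) (n : nat) (x : 'rV[R]_n) (c : R) : 0 <= c ->
  (`|x| <= c) <-> (forall i, `|x 0 i| <= c).
Proof.
move=> c0; rewrite [X in X <= _](_ : _ = mx_norm x)// mx_normrE; split.
  move=> /bigmax_leP[_ h] i; exact: (h (0, i)).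
by move=> h; apply/bigmax_leP; split => // -[i j] _ /=; rewrite ord1.
Qed.

Lemma rv_coord_le (R : realType) (n : nat) (x : 'rV[R]_n) i : `|x 0 i| <= `|x|.
Proof. by move: i; apply/rv_norm_leP. Qed.

Section euclidean.
Context {R : realType}.

Lemma enorm_ge0 n (x : 'rV[R]_n) : 0 <= enorm x.
Proof. exact: sqrtr_ge0. Qed.

Lemma euclidean_dist_ge0 n (x y : 'rV[R]_n) : 0 <= euclidean_dist x y.
Proof. exact: enorm_ge0. Qed.

Lemma norm_dist_ge0 (V : normedModType R) (x y : V) : 0 <= norm_dist x y.
Proof. exact: normr_ge0. Qed.

Lemma norm_le_enorm n (x : 'rV[R]_n) : `|x| <= enorm x.
Proof.
apply/rv_norm_leP; first exact: enorm_ge0.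
move=> i; rewrite -sqrtr_sqr ler_wsqrtr// (bigD1 i)//= lerDl.
by apply: sumr_ge0 => j _; exact: sqr_ge0.
Qed.

Lemma enorm_le_norm n (x : 'rV[R]_n) : enorm x <= n%:R * `|x|.
Proof.
have x0 : 0 <= n%:R * `|x| by rewrite mulr_ge0.
rewrite -[leRHS]ger0_norm// -sqrtr_sqr ler_wsqrtr//.
apply: (@le_trans _ _ (\sum_(i < n) `|x| ^+ 2)).
  apply: ler_sum => i _; rewrite -[x 0 i ^+ 2]real_normK ?num_real//.
  by rewrite lerXn2r ?nnegrE//; exact: rv_coord_le.
rewrite sumr_const card_ord -[_ *+ n]mulr_natl exprMn ler_wpM2r ?sqr_ge0//.
case: n {x x0} => [|n]; first by rewrite expr0n.
by rewrite expr2 ler_peMr// ler1n.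
Qed.

Lemma enormZ n c (x : 'rV[R]_n) : enorm (c *: x) = `|c| * enorm x.
Proof.
rewrite /enorm -sqrtr_sqr -sqrtrM ?sqr_ge0//; congr Num.sqrt.
by rewrite mulr_sumr; apply: eq_bigr => i _; rewrite mxE exprMn.
Qed.

Lemma null_cover_euclidean n s (A : set 'rV[R]_n) : 0 < s ->
  null_cover (@euclidean_dist R n) s A <-> null_cover (@norm_dist R 'rV[R]_n) s A.
Proof.
move=> s0; split => h; rewrite -[A]image_id.
  apply: null_cover_lipschitz s0 (@ltr01 R) _ h => x y _ _.
  by rewrite mul1r; exact: norm_le_enorm.
apply: null_cover_lipschitz s0 (ltr0Sn R n) _ h => x y _ _.
apply: le_trans (enorm_le_norm _) _.
by rewrite ler_wpM2r ?norm_dist_ge0// ler_nat.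
Qed.

End euclidean.

(** * The unit cube has positive measure *)

(** After a shift by a fixed member [g0], each coordinate takes at most [2 * D + 1] values; the
    added [D] keeps the natural subtraction from truncating. *)
Lemma card_ffun_close (n N D : nat) (S : {set {ffun 'I_n -> 'I_N}}) :
  (forall g h, g \in S -> h \in S -> forall j, (g j <= h j + D)%N) ->
  (#|S| <= (D + D).+1 ^ n)%N.
Proof.
move=> SD; have [->|[g0 g0S]] := set_0Vmem S; first by rewrite cards0.
pose f (g : {ffun 'I_n -> 'I_N}) : {ffun 'I_n -> 'I_(D + D).+1} :=
  [ffun j => inord (g j + D - g0 j)%N].
rewrite -(@card_in_imset _ _ f).
  by rewrite (leq_trans (max_card _))// card_ffun !card_ord.
move=> g h gS hS /ffunP fgh; apply/ffunP => j; apply: val_inj => /=.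
have bound (a b : nat) : (a <= b + D)%N -> (a + D - b < (D + D).+1)%N by lia.
have cancel (a b c : nat) : (c <= a + D)%N -> (c <= b + D)%N ->
  (a + D - c = b + D - c)%N -> a = b by lia.
have := congr1 val (fgh j); rewrite !ffunE /= !inordK ?bound ?SD//.
by apply: cancel; exact: SD.
Qed.

Definition unit_cube (R : realType) (n : nat) : set 'rV[R]_n :=
  [set x | forall i, 0 <= x 0 i <= 1].

Lemma compact_unit_cube (R : realType) (n : nat) : compact (@unit_cube R n).
Proof.
rewrite [X in compact X](_ : _ = [set v : 'rV_n | forall i, `[0%R, 1%R]%classic (v 0 i)]).
  exact: (rV_compact (fun=> @segment_compact R 0 1)).
by apply/seteqP; split => x h i; have := h i; rewrite /= ?in_itv.
Qed.

(** A finite subcover is tested against a grid of [N ^ n] points of mesh [1 / N]: the set of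
    diameter [r i] holds at most [(3 * r i * N) ^ n] of them, so the [(3 * r i) ^ n] add up to at
    least 1, against the choice of [e]. *)
Lemma unit_cube_not_null (R : realType) (n : nat) (s : R) :
  0 < s <= n%:R -> ~ null_cover (@norm_dist R 'rV[R]_n) s (@unit_cube R n).
Proof.
move=> /andP[s0 sn] nQ.
pose e : R := (3 ^+ n)^-1 / 2.
have e30 : 0 < (3 ^+ n)^-1 :> R by rewrite invr_gt0 exprn_gt0.
have e0 : 0 < e by rewrite divr_gt0.
have e1 : e <= 1.
  rewrite /e ler_pdivrMr// mul1r (@le_trans _ _ 1)//; last by lra.
  by rewrite invf_le1 ?exprn_gt0// exprn_ege1//; lra.
have [U [r [r0 Ur QU rs Uo]]] := null_cover_open s0 e0 nQ.
(* Compactness enters as one bound [M] on the indices used, valid for the whole cube. *)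
have [M _ /(_ M (leqnn M)) /= QM] : \forall M \near \oo,
    @unit_cube R n `<=` fun x => exists2 i, (i < M)%N & U i x.
  apply: ((compact_near_coveringP _).1 (@compact_unit_cube R n)) => x /QU[i _ Ux].
  exists (U i, [set M | (i < M)%N]) => /=.
    split; last by exists i.+1.
    by apply: open_nbhs_nbhs; split.
  by move=> [y M] /= [Uy iM]; exists i.
(* The mesh is finer than every radius of the subcover, so [r i * N] is at least 1; with [D] its
   integer part, [2 * D + 1] is then at most [3 * (r i * N)]. *)
pose N := (\max_(i < M) Num.bound (r i)^-1).+1.
have N0 : 0 < N%:R :> R by rewrite ltr0n.
have rN (i : 'I_M) : 1 <= r i * N%:R.
  have := archi_boundP (ltW (_ : 0 < (r i)^-1)); rewrite invr_gt0 r0 => /(_ isT) h.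
  rewrite -ler_pdivrMl// mulr1 (le_trans (ltW h))// ler_nat leqW//.
  exact: (leq_bigmax i).
pose pt (g : {ffun 'I_n -> 'I_N}) : 'rV[R]_n := \row_j ((g j)%:R / N%:R).
have ptQ g : @unit_cube R n (pt g).
  move=> i; rewrite mxE divr_ge0//= ler_pdivrMr// mul1r ler_nat.
  exact: ltnW.
have /choice[c cP] : forall g, exists i : 'I_M, U i (pt g).
  by move=> g; have [i iM Ui] := QM _ (ptQ g); exists (Ordinal iM).
have cardc (i : 'I_M) :
    #|[set g | c g == i]%SET|%:R <= (3 * (r i * N%:R)) ^+ n :> R.
  pose D := Num.truncn (r i * N%:R).
  have rN0 : 0 <= r i * N%:R by rewrite mulr_ge0// ltW.
  have /andP[D1 D2] : D%:R <= r i * N%:R < D.+1%:R by exact: truncn_itv.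
  apply: (@le_trans _ _ ((D + D).+1%:R ^+ n)).
    rewrite -natrX ler_nat; apply: card_ffun_close => g h; rewrite !inE.
    move=> /eqP cg /eqP ch j.
    have := Ur i _ _ (_ : U i (pt g)) (_ : U i (pt h)).
    rewrite -{1}cg -{1}ch => /(_ (cP g) (cP h)) gh.
    have {gh} := le_trans (rv_coord_le _ j) gh; rewrite !mxE -mulrBl.
    rewrite normrM (@ger0_norm _ N%:R^-1) ?invr_ge0 ?ler0n//.
    rewrite ler_pdivrMr// => gh; have {gh} := le_trans (ler_norm _) gh.
    rewrite lerBlDl => gh; have {gh} := le_lt_trans gh _.
    move=> /(_ _ (_ : _ < (h j)%:R + D.+1%:R)); rewrite ltrD2l => /(_ D2).
    by rewrite -natrD ltr_nat addnS ltnS.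
  have D2R : (D + D).+1%:R = D%:R + D%:R + 1 :> R by rewrite -natr1 natrD.
  apply: lerXn2r; rewrite ?nnegrE; [exact: ler0n|by rewrite mulr_ge0|].
  rewrite D2R; have := rN i; lra.
have : N%:R ^+ n <= \sum_(i < M) (3 * (r i * N%:R)) ^+ n :> R.
  apply: (@le_trans _ _ (\sum_(i < M) #|[set g | c g == i]%SET|%:R)); last exact: ler_sum.
  rewrite -natr_sum -natrX ler_nat.
  have := card_ffun 'I_n 'I_N; rewrite !card_ord => <-.
  rewrite -sum1_card (partition_big c xpredT)//= leq_sum// => i _.
  by rewrite -sum1_card; apply/eq_leq/eq_bigl => g; rewrite inE.
under eq_bigr do rewrite mulrA exprMn [(3 * _) ^+ _]exprMn.
rewrite -mulr_suml -mulr_sumr -[leLHS]mul1r ler_pM2r ?exprn_gt0//.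
apply/negP; rewrite -ltNge.
(* All radii are at most 1 because [e] is; as [s <= n], the sum with exponent [n] is bounded by the
   one with exponent [s]. *)
have : \sum_(i < M) r i ^+ n <= e.
  rewrite -lee_fin -sumEFin; apply: le_trans (rs).
  apply: le_trans (nneseries_lim_ge M _); last by move=> j _ _; rewrite lee_fin powR_ge0.
  rewrite big_mkord; apply: lee_sum => i _; rewrite lee_fin -powR_mulrn ?(ltW (r0 _))//.
  apply: ger_powR => //; rewrite r0/=.
  apply: (powR_le_base s0) => //; first exact: ltW.
  by rewrite powR1 (le_trans _ e1)// (nneseries_term_le i _ rs)// => j; exact: powR_ge0.
move=> h; apply: (@le_lt_trans _ _ (3 ^+ n * e)).
  by rewrite ler_pM2l// exprn_gt0.
by rewrite /e mulrA divff ?gt_eqF ?exprn_gt0//; lra.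
Qed.

(** * Lines and slices *)

Section vcons.
Context {R : realType} {n : nat}.
Implicit Types (p : 'rV[R]_n.+1) (v w : 'rV[R]_n) (t : R).

(** Written with the same [row_mx] as in [slice], so that [slice B t x] unfolds to
    [B (vcons t x)]. *)
Definition vcons t w : 'rV[R]_n.+1 := row_mx (t%:M : 'rV[R]_1) w.

Definition vtail p : 'rV[R]_n := \row_i p 0 (lift ord0 i).

Lemma vcons0 t w : vcons t w 0 ord0 = t. Proof.
transitivity (row_mx (t%:M : 'rV[R]_1) w 0 (lshift n ord0)).
  by congr (fun_of_matrix _ _ _); exact: val_inj.
by rewrite row_mxEl mxE eqxx mulr1n.
Qed.

Lemma vconsS t w i : vcons t w 0 (lift ord0 i) = w 0 i.
Proof.
transitivity (row_mx (t%:M : 'rV[R]_1) w 0 (rshift 1 i)).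
  by congr (fun_of_matrix _ _ _); exact: val_inj.
by rewrite row_mxEr.
Qed.

Lemma vtail_vcons t w : vtail (vcons t w) = w.
Proof. by apply/rowP => i; rewrite mxE vconsS. Qed.

Lemma vcons_linear c t t' w w' :
  vcons t w + c *: vcons t' w' = vcons (t + c * t') (w + c *: w').
Proof.
apply/rowP => i; rewrite mxE [X in _ + X]mxE.
case: (unliftP ord0 i) => [j|] ->; last by rewrite !vcons0.
by rewrite !vconsS mxE [X in _ = _ + X]mxE.
Qed.

Lemma vec_norm_le p c : 0 <= c -> `|p 0 ord0| <= c ->
  (forall i, `|p 0 (lift ord0 i)| <= c) -> `|p| <= c.
Proof.
move=> c0 p0 pS; apply/rv_norm_leP => // i.
by case: (unliftP ord0 i) => [j|] ->.
Qed.

Lemma vcons_norm_le t v w : `|v - w| <= `|vcons t v - vcons t w|.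
Proof.
apply/rv_norm_leP => // i.
have := rv_coord_le (vcons t v - vcons t w) (lift ord0 i).
by rewrite mxE [X in _ + X]mxE !vconsS !mxE.
Qed.

Lemma enorm_vcons10 : enorm (vcons 1 0) = 1.
Proof.
rewrite /enorm big_ord_recl vcons0 expr1n big1 ?addr0 ?sqrtr1// => i _.
by rewrite vconsS mxE expr0n.
Qed.

Lemma vcons_ball t w e t' w' :
  ball t e t' -> ball w e w' -> ball (vcons t w) e (vcons t' w').
Proof.
move=> tt' [e0 ww']; split => // i j; rewrite ord1.
by case: (unliftP ord0 j) => [k|] ->; rewrite ?vcons0 ?vconsS.
Qed.

Lemma vcons_continuous : continuous (fun p : R * 'rV[R]_n => vcons p.1 p.2).
Proof.
move=> [t w] /= S /nbhs_ballP[e e0 eS]; apply/nbhs_ballP; exists e => //.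
by move=> [t' w'] [/= tt' ww']; apply: eS; exact: vcons_ball.
Qed.

(** The pair is (slope, intercept): the line meets [t = 0] in [av.2] and moves with velocity
    [av.1]. *)
Definition line_pt t (av : 'rV[R]_n * 'rV[R]_n) : 'rV[R]_n.+1 :=
  vcons t (av.2 + t *: av.1).

Lemma line_pt_continuous :
  continuous (fun p : R * ('rV[R]_n * 'rV[R]_n) => line_pt p.1 p.2).
Proof.
move=> p; rewrite /line_pt.
have h2 : (fun p : R * ('rV[R]_n * 'rV[R]_n) => p.2) @ p --> p.2 by exact: cvg_snd.
have h1 : (fun p : R * ('rV[R]_n * 'rV[R]_n) => p.1) @ p --> p.1 by exact: cvg_fst.
have h21 : (fun p : R * ('rV[R]_n * 'rV[R]_n) => p.2.1) @ p --> p.2.1.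
  by apply: cvg_comp h2 _; exact: cvg_fst.
have h22 : (fun p : R * ('rV[R]_n * 'rV[R]_n) => p.2.2) @ p --> p.2.2.
  by apply: cvg_comp h2 _; exact: cvg_snd.
have h : (fun p : R * ('rV[R]_n * 'rV[R]_n) => (p.1, p.2.2 + p.1 *: p.2.1)) @ p
    --> (p.1, p.2.2 + p.1 *: p.2.1).
  have h3 : (fun p : R * ('rV[R]_n * 'rV[R]_n) => p.2.2 + p.1 *: p.2.1) @ p
      --> p.2.2 + p.1 *: p.2.1 by apply: cvgD => //; exact: cvgZ.
  exact: (cvg_pair h1 h3).
have hv := @vcons_continuous (p.1, p.2.2 + p.1 *: p.2.1).
exact: (cvg_comp _ _ h hv).
Qed.

End vcons.

(** * Slices of null sets *)

Lemma rdist_ge0 (R : realType) (x y : R) : 0 <= rdist x y.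
Proof. exact: normr_ge0. Qed.

(** Lebesgue measure is an infimum over covers by half-open intervals, whose lengths bound their
    diameters; the added geometric terms keep the radii positive for empty intervals. *)
Lemma null_cover_of_lebesgue (R : realType) (N : set (measurableTypeR R)) :
  lebesgue_measure N = 0%E -> null_cover (@rdist R) 1 N.
Proof.
move=> N0 e e0.
have : (lebesgue_measure N < (e / 2)%:E)%E by rewrite N0 lte_fin divr_gt0.
move=> /ereal_inf_lt[z [/= M [mM NM] sMz zDe]].
pose e2 n := ((e / 2) / (2 ^ n.+1)%:R)%R.
have e20 n : 0 < e2 n by rewrite !divr_gt0// ltr0n expn_gt0.
have /choice[r rP] : forall i, exists r : R, [/\ 0 < r,
    forall x y, M i x -> M i y -> rdist x y <= r &
    ((r `^ 1)%:E <= wlength idfun (M i) + (e2 i)%:E)%E].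
  move=> i; have [[a b] _ /= Mi] : ocitv (M i) := mM i.
  exists (Num.max (b - a) 0 + e2 i); split.
  - by rewrite ltr_wpDl// le_max lexx orbT.
  - move=> x y; rewrite -Mi /= !in_itv/= => /andP[ax xb] /andP[ay yb].
    rewrite /rdist; apply: (@le_trans _ _ (b - a)).
      by rewrite ler_norml; apply/andP; split; lra.
    by rewrite (@le_trans _ _ (Num.max (b - a) 0)) ?le_max ?lexx// lerDl ltW.
  - rewrite powRr1; last by rewrite addr_ge0 ?(ltW (e20 i))// le_max lexx orbT.
    rewrite EFinD leeD2r// -Mi wlength_itv/= lte_fin.
    case: ltP => ab; first by rewrite max_l ?subr_ge0 ?(ltW ab)// EFinB.
    by rewrite max_r// subr_le0.
exists M, r; split => //.
- by move=> i; have [] := rP i.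
- by move=> i; have [] := rP i.
- apply: (@le_trans _ _ (\sum_(i <oo) (wlength idfun (M i) + (e2 i)%:E))%E).
    apply: lee_nneseries => i; first by move=> _ _; rewrite lee_fin powR_ge0.
    by move=> _; have [] := rP i.
  apply: le_trans (epsilon_trick _ _ _) _.
  + by move=> i; exact: measure_ge0.
  + by rewrite divr_ge0// ltW.
  rewrite [leRHS](_ : _ = (e/2)%:E + (e/2)%:E)%E; last by rewrite -EFinD -splitr.
  by rewrite leeD2r// ltW// sMz.
Qed.

Section slices.
Context {R : realType}.
Local Open Scope ereal_scope.

(* Chebyshev's inequality bounds the measure of the points that lie in too many
   of the intervals, each counted with the weight [r i `^ q]. *)
Lemma weighted_intervals_measure (q eps a : R) (r c : nat -> R) :
  (0 < q)%R -> (0 < a)%R ->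
  (forall i, (0 < r i)%R) ->
  \sum_(i <oo) (r i `^ (q + 1))%:E <= eps%:E ->
  let f t := \sum_(i <oo)
    (r i `^ q)%:E * (\1_(`[(c i - r i)%R, (c i + r i)%R]%classic) t)%:E in
  measurable [set t : measurableTypeR R | a%:E < f t] /\
  lebesgue_measure [set t : measurableTypeR R | a%:E < f t] <= (2 * eps / a)%:E.
Proof.
move=> q0 a0 r0 rs f.
pose J i : set (measurableTypeR R) := `[(c i - r i)%R, (c i + r i)%R]%classic.
pose g i (t : measurableTypeR R) := (r i `^ q)%:E * (\1_(J i) t)%:E : \bar R.
have mJ i : measurable (J i) by exact: measurable_itv.
have g0 i t : 0 <= g i t by rewrite mule_ge0// lee_fin ?powR_ge0.
have mg i : measurable_fun (setT : set (measurableTypeR R)) (g i).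
  apply: measurable_funeM; apply/measurable_EFinP; exact: measurable_indic.
have mf : measurable_fun (setT : set (measurableTypeR R)) f.
  apply: (@ge0_emeasurable_sum _ _ _ setT g xpredT) => [k t _ _|k _].
    exact: g0.
  exact: mg.
have f0 t : 0 <= f t by apply: nneseries_ge0 => i _ _; exact: g0.
pose mu := @lebesgue_measure R.
have Zl (k : R) (A : set (measurableTypeR R)) : measurable A -> (0 <= k)%R ->
    \int[mu]_(t in setT) (k%:E * (\1_A t)%:E) = k%:E * mu A.
  move=> mA k0; rewrite ge0_integralZl_EFin//.
  - by rewrite integral_indic// setIT.
  - by apply/measurable_EFinP; exact: measurable_indic.
have If : \int[mu]_(t in setT) f t <= (2 * eps)%:E.
  rewrite /f (integral_nneseries mu measurableT (f := g))//.
  apply: (@le_trans _ _ (\sum_(i <oo) 2%:E * (r i `^ (q + 1))%:E)).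
    apply: lee_nneseries => i _; first by move=> _; exact: integral_ge0.
    rewrite /g Zl ?powR_ge0// /mu lebesgue_measure_itv/= lte_fin.
    have -> : (c i - r i < c i + r i)%R by have := r0 i; lra.
    rewrite -EFinB -!EFinM lee_fin powRD; last by rewrite (gt_eqF (r0 i)) implybT.
    rewrite powRr1 ?(ltW (r0 i))// mulrA [(2 * _)%R]mulrC -mulrA ler_wpM2l ?powR_ge0//.
    lra.
  rewrite nneseriesZl; last by move=> i _; rewrite lee_fin powR_ge0.
  by rewrite EFinM lee_wpmul2l.
have mE : measurable [set t : measurableTypeR R | a%:E < f t].
  by rewrite -[X in measurable X]setTI; exact: emeasurable_fun_o_infty.
split => //.
set E := [set t | _] in mE *.
have : \int[mu]_(t in setT) (a%:E * (\1_E t)%:E) <= (2 * eps)%:E.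
  apply: le_trans If; apply: ge0_le_integral => //.
  - by move=> t _; rewrite mule_ge0// lee_fin ltW.
  - by apply: measurable_funeM; apply/measurable_EFinP; exact: measurable_indic.
  - move=> t _; rewrite indicE; case: (boolP (t \in E)) => [|_].
      by rewrite inE mule1 => /ltW.
    by rewrite mule0.
rewrite Zl ?(ltW a0)// => h.
by rewrite -(@lee_pmul2l _ a%:E)// -EFinM mulrC divfK// gt_eqF.
Qed.

(** A Fubini-type inequality. For a cover of total at most [1 / l.+1], the [t] at which [f l t]
    exceeds [1 / j.+1] have measure at most [2 * j.+1 / l.+1]. Those that do so for every [l] form
    the null set [Z j]; off all the [Z j], some [f l t] is as small as desired and bounds the cost
    of covering the slice. *)
Lemma null_cover_slices (n : nat) (q : R) (A : set 'rV[R]_n.+1) : (0 < q)%R ->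
  null_cover (@norm_dist R 'rV[R]_n.+1) (q + 1)%R A ->
  null_cover (@rdist R) 1%R
    [set t | ~ null_cover (@norm_dist R 'rV[R]_n) q (slice A t)].
Proof.
move=> q0 nA.
have eps0 l : (0 < l.+1%:R^-1 :> R)%R by rewrite invr_gt0.
have /choice[U /choice[r UrP]] := fun l => nA _ (eps0 l).
have r0 l i : (0 < r l i)%R by have [] := UrP l.
(* [c] records the first coordinate of a point of the set, so the set lies over the interval of
   radius [r] about it. *)
have /choice[c cP] : forall li : nat * nat, exists c : R,
    forall x, U li.1 li.2 x -> (`|x 0 ord0 - c| <= r li.1 li.2)%R.
  move=> [l i] /=.
  have [->|/set0P[y Uy]] := eqVneq (U l i) set0; first by exists 0%R.
  exists (y 0 ord0)%R => x Ux.
  have [_ /(_ i _ _ Ux Uy) + _ _] := UrP l.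
  by apply: le_trans; have := rv_coord_le (x - y) ord0; rewrite !mxE.
pose f l t := \sum_(i <oo) (r l i `^ q)%:E *
  (\1_(`[(c (l, i) - r l i)%R, (c (l, i) + r l i)%R]%classic) t)%:E.
pose Z j : set (measurableTypeR R) :=
  \bigcap_l [set t : measurableTypeR R | (j.+1%:R^-1)%:E < f l t].
have rs l : \sum_(i <oo) (r l i `^ (q + 1))%:E <= (l.+1%:R^-1)%:E.
  by have [] := UrP l.
have fP j l := weighted_intervals_measure (fun i => c (l, i))
  q0 (eps0 j) (r0 l) (rs l).
have Z0 j : lebesgue_measure (Z j) = 0.
  have mZ : measurable (Z j) by apply: bigcap_measurable => // l _; exact: (fP j l).1.
  apply/eqP; rewrite eq_le measure_ge0 andbT.
  apply/lee_addgt0Pr => e e0; rewrite add0e.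
  pose l := Num.truncn (2 * j.+1%:R / e)%R.
  apply: (@le_trans _ _ (lebesgue_measure
    [set t : measurableTypeR R | (j.+1%:R^-1)%:E < f l t])).
    apply: le_measure; rewrite ?inE//; first exact: (fP j l).1.
    by move=> t; exact.
  apply: le_trans (fP j l).2 _; rewrite lee_fin invrK mulrAC.
  rewrite ler_pdivrMr// -ler_pdivrMl// mulrC ltW//.
  exact: truncnS_gt.
apply: (@null_coverS _ _ _ _ _ (\bigcup_j Z j)); last first.
  apply: null_cover_bigcup => // j; exact: null_cover_of_lebesgue.
move=> t /= ntA; apply: contrapT => nZt; apply: ntA => e e0.
have [l fl] : exists l, f l t <= (e / 2)%:E.
  pose j := Num.truncn (2 / e)%R.
  have je : (j.+1%:R^-1 <= e / 2 :> R)%R.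
    rewrite -[leRHS]invrK lef_pV2 ?posrE ?invr_gt0 ?divr_gt0// invf_div.
    by rewrite ltW// truncnS_gt.
  apply: contrapT => /forallNP h; apply: nZt; exists j => // l _ /=.
  rewrite ltNge; apply/negP => le; apply: (h l).
  by apply: le_trans le _; rewrite lee_fin.
(* Indices whose interval omits [t] have empty slices, but their radii must still be positive: they
   get small ones of total [e / 2]. *)
pose tiny i := ((e / 2) / (2 ^ i.+1)%:R)%R.
have tiny0 i : (0 < tiny i)%R by rewrite !divr_gt0// ltr0n expn_gt0.
pose inJ i := t \in `[(c (l, i) - r l i)%R, (c (l, i) + r l i)%R]%classic.
exists (fun i => slice (U l i) t),
  (fun i => if inJ i then r l i else tiny i `^ q^-1)%R; split.
- by move=> i; case: ifP => // _; exact: powR_gt0.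
- move=> i x y Ux Uy; rewrite ifT.
    have [_ /(_ i _ _ Ux Uy) + _ _] := UrP l.
    by apply: le_trans; exact: vcons_norm_le.
  have := cP (l, i) _ Ux; rewrite vcons0 /= => h.
  by rewrite /inJ inE/= in_itv/= -ler_distl.
- move=> x Ax; have [_ _ /(_ _ Ax)[i _ Ux] _] := UrP l.
  by exists i.
- apply: (@le_trans _ _ (\sum_(i <oo) ((r l i `^ q)%:E *
    (\1_(`[(c (l, i) - r l i)%R, (c (l, i) + r l i)%R]%classic) t)%:E
    + (tiny i)%:E))).
    apply: lee_nneseries => i; first by move=> _ _; rewrite lee_fin powR_ge0.
    move=> _; rewrite indicE -/(inJ i); case: (inJ i) => /=.
      by rewrite mule1 leeDl// lee_fin ltW.
    by rewrite mule0 add0e powR_invK ?(ltW (tiny0 i))// gt_eqF.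
  apply: le_trans (epsilon_trick _ _ _) _.
  + by move=> i; rewrite mule_ge0// lee_fin powR_ge0.
  + by rewrite divr_ge0// ltW.
  rewrite [leRHS](_ : _ = (e/2)%:E + (e/2)%:E); last by rewrite -EFinD -splitr.
  by rewrite leeD2r.
Qed.

End slices.

(** * Lines through a compact set of directions *)

Section compact_selection.
Context {R : realType} {X Y : normedModType R}.
Variable Q : set Y.
Hypothesis cQ : compact Q.
Implicit Types C W : set (X * Y).

Definition section_dense (W : set (X * Y)) : Prop :=
  forall y x e, Q y -> 0 < e -> exists2 x', ball x e x' & W (x', y).

(** The invariant of the nested construction. The interior is taken in the product, so that one [x]
    serves a whole neighbourhood of [y]. *)
Definition section_interior (C : set (X * Y)) : Prop :=
  forall y, Q y -> exists x, C^° (x, y).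

(** A Lebesgue number argument: the [x] chosen for [y] also works, with half the radius, for all
    nearby points, and compactness of [Q] makes the radius uniform. *)
Lemma open_uniform_ball W : open W -> (forall y, Q y -> exists x, W (x, y)) ->
  exists2 rho : R, 0 < rho &
    forall y, Q y -> exists x, ball (x, y) rho `<=` W.
Proof.
move=> oW QW.
have : \forall rho \near 0^'+, Q `<=` fun y => exists x, ball (x, y) rho `<=` W.
  apply: ((compact_near_coveringP _).1 cQ) => y /QW[x Wxy].
  have /nbhs_ballP[e /= e0 eW] : nbhs (x, y) W by exact: open_nbhs_nbhs.
  exists (ball y (e / 2), [set rho | rho < e / 2]) => /=.
    split; first by apply: nbhsx_ballx; rewrite divr_gt0.
    by apply: nbhs_right_lt; rewrite divr_gt0.
  move=> [y' rho] /= [yy' rhoe]; exists x => q xq; apply: eW.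
  rewrite [e]splitr; apply: (@ball_triangle _ _ (x, y')).
    by split => //=; apply: ballxx; rewrite divr_gt0.
  exact: le_ball (ltW rhoe) _ xq.
move=> nQ; near (0 : R)^'+ => rho; exists rho => //.
by near: rho; exact: nQ.
Unshelve. all: by end_near. Qed.

(** Density moves an interior point of [C] into [W] without leaving the interior. The points whose
    ball of radius [rho / 2] lies inside both sets form a closed set, which contains a ball of that
    radius about the centre of each ball of radius [rho]. *)
Lemma shrink_section C W : open W -> section_dense W -> section_interior C ->
  exists C', [/\ closed C', C' `<=` C, C' `<=` W & section_interior C'].
Proof.
move=> oW dW iC.
have oCW : open (C^° `&` W) by apply: openI => //; exact: open_interior.
have [rho rho0 rhoP] : exists2 rho : R, 0 < rho &
    forall y, Q y -> exists x, ball (x, y) rho `<=` C^° `&` W.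
  apply: open_uniform_ball => // y Qy; have [x Cxy] := iC y Qy.
  have /nbhs_ballP[e /= e0 eC] : nbhs (x, y) (C^°).
    by apply: open_nbhs_nbhs; split => //; exact: open_interior.
  have [x' xx' Wx'] := dW y x e Qy e0; exists x'; split => //.
  by apply: eC; split => //=; exact: ballxx.
exists [set p | ball p (rho / 2) `<=` C^° `&` W]; split.
- rewrite -openC [X in open X](_ : _ =
      \bigcup_(q in ~` (C^° `&` W)) ball q (rho / 2)).
    by apply: bigcup_open => q _; exact: ball_open.
  apply/seteqP; split => p /=.
    move=> /existsNP[q /not_implyP[pq nq]]; exists q => //.
    exact: ball_sym.
  by move=> [q nq qp] h; apply: nq; apply: h; exact: ball_sym.
- move=> p h; apply: interior_subset.
  by have [] := h p (ballxx p (divr_gt0 rho0 (ltr0n _ 2))).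
- by move=> p h; have [] := h p (ballxx p (divr_gt0 rho0 (ltr0n _ 2))).
- move=> y Qy; have [x xP] := rhoP y Qy; exists x.
  apply/nbhs_ballP; exists (rho / 2); first by rewrite /= divr_gt0.
  move=> p xyp q pq; apply: xP; rewrite [rho]splitr.
  exact: ball_triangle xyp pq.
Qed.

(** A Baire-type argument run over all [y] at once: closed sets [C k] shrink into the [O k], and a
    cluster point of the pairs [(x k, y)] in [C k] lies in all of them and keeps the second
    coordinate [y]. *)
Lemma compact_selection (O : nat -> set (X * Y)) (C0 : set (X * Y)) :
  closed C0 -> compact C0 -> section_interior C0 ->
  (forall k, open (O k)) -> (forall k, section_dense (O k)) ->
  exists K : set (X * Y), [/\ compact K, K `<=` \bigcap_k O k &
    forall y, Q y -> exists x, K (x, y)].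
Proof.
move=> clC0 cC0 iC0 oO dO.
(* The hypothesis sits inside the existential so that [choice] yields a total function, which the
   recursion [C] can iterate. *)
have /choice[f fP] : forall kC : nat * set (X * Y), exists C',
    section_interior kC.2 ->
    [/\ closed C', C' `<=` kC.2, C' `<=` O kC.1 & section_interior C'].
  move=> [k C] /=; have [iC|] := pselect (section_interior C); last by exists C.
  by have [C' C'P] := shrink_section (oO k) (dO k) iC; exists C'.
pose C := fix C k := if k is k'.+1 then f (k', C k') else C0.
have iC k : section_interior (C k).
  by elim: k => [//|k ih]; have [] := fP (k, C k) ih.
have clC k : closed (C k).
  by case: k => [//|k]; have [] := fP (k, C k) (iC k).
have CS k : C k.+1 `<=` C k by have [] := fP (k, C k) (iC k).
have CO k : C k.+1 `<=` O k by have [] := fP (k, C k) (iC k).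
have Cdec k j : (k <= j)%N -> C j `<=` C k.
  move=> /subnK <-; elim: (j - k)%N => [//|i ih].
  by rewrite addSn; exact: subset_trans (CS _) ih.
exists (\bigcap_k C k); split.
- apply: (subclosed_compact _ cC0); first exact: closed_bigI.
  by move=> p /(_ 0%N); exact.
- by move=> p Kp k _; apply: CO; exact: Kp.
- move=> y Qy.
  have /choice[x xP] : forall k, exists x, C k (x, y).
    by move=> k; have [x /interior_subset] := iC k y Qy; exists x.
  pose u k := (x k, y).
  have uC k : (u @ \oo) (C k).
    by exists k => // j /= kj; apply: (Cdec _ _ kj); exact: xP.
  have [[p1 p2] [Cp clp]] := cC0 (u @ \oo) _ (uC 0%N).
  have pC k : C k (p1, p2).
    by apply: clC => B Bp; exact: clp (uC k) Bp.
  have <- : p2 = y.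
    apply/eqP; rewrite -subr_eq0 -normr_le0; apply/ler_addgt0Pl => e e0.
    rewrite addr0.
    have uy : (u @ \oo) [set p | p.2 = y] by exists 0%N.
    have [[q1 q2] [/= -> [_ /=]]] := clp _ _ uy (nbhsx_ballx (p1, p2) e e0).
    by rewrite -ball_normE => h; exact: ltW.
  by exists p1 => k _.
Qed.

End compact_selection.

(** * Projective copies of a Besicovitch set *)

Lemma null_cover_bigcup_count (R : realType) (T : Type) (d : T -> T -> R)
    (I : countType) (i0 : I) (s : R) (A : I -> set T) :
  0 < s -> (forall i, null_cover d s (A i)) -> null_cover d s (\bigcup_i A i).
Proof.
(* [i0] stands in for the numbers that code no index. *)
move=> s0 nA; apply: (@null_coverS _ _ _ _ _
    (\bigcup_k A (odflt i0 (unpickle k)))); last exact: null_cover_bigcup.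
by move=> x [i _ Ax]; exists (pickle i) => //; rewrite pickleK.
Qed.

Section projective.
Context {R : realType} {n : nat}.
Implicit Types (p q : 'rV[R]_n.+1) (a v w : 'rV[R]_n).

(** Off [x = 0] this is an involution exchanging slope and intercept: [(x, a + x v)] goes to
    [(t, v + t a)] with [t = 1 / x]. The direction of a segment thus becomes the point of a line at
    [t = 0]. *)
Definition projective_inv q : 'rV[R]_n.+1 :=
  vcons (q 0 ord0)^-1 ((q 0 ord0)^-1 *: vtail q).

Definition box (j : nat) : set 'rV[R]_n.+1 :=
  [set q : 'rV[R]_n.+1 | j.+1%:R^-1 <= `|q 0 ord0| /\ `|q| <= j.+1%:R].

Lemma inv_lipschitz (m x y : R) : 0 < m -> m^-1 <= `|x| -> m^-1 <= `|y| ->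
  `|x^-1 - y^-1| <= m ^+ 2 * `|x - y|.
Proof.
move=> m0 mx my; have mV : 0 < m^-1 by rewrite invr_gt0.
have x0 : x != 0 by rewrite -normr_gt0 (lt_le_trans mV).
have y0 : y != 0 by rewrite -normr_gt0 (lt_le_trans mV).
have xm : `|x|^-1 <= m by rewrite -[m]invrK lef_pV2 ?posrE ?normr_gt0.
have ym : `|y|^-1 <= m by rewrite -[m]invrK lef_pV2 ?posrE ?normr_gt0.
rewrite (_ : x^-1 - y^-1 = (y - x) * (x^-1 * y^-1)); last by field; rewrite x0 y0.
rewrite normrM normrM !normfV distrC mulrC ler_wpM2r// expr2.
by apply: ler_pM => //; rewrite invr_ge0.
Qed.

(** With [m = j.+1], the first coordinate needs the constant [m ^+ 2] and the others [m ^+ 3 + m];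
    the sum serves both. *)
Lemma projective_inv_lipschitz j p q : box j p -> box j q ->
  `|projective_inv p - projective_inv q| <=
    (j.+1%:R ^+ 3 + j.+1%:R ^+ 2 + j.+1%:R) * `|p - q|.
Proof.
move=> [p1 p2] [q1 q2]; set m : R := j.+1%:R in p1 p2 q1 q2 *.
have m0 : 0 < m by rewrite ltr0n.
have m3 : 0 <= m ^+ 3 by rewrite exprn_ge0// ltW.
have m2 : 0 <= m ^+ 2 by rewrite exprn_ge0// ltW.
have pq0 : `|p 0 ord0 - q 0 ord0| <= `|p - q|.
  by have := rv_coord_le (p - q) ord0; rewrite !mxE.
have inv_le : `|(p 0 ord0)^-1 - (q 0 ord0)^-1| <= m ^+ 2 * `|p - q|.
  by apply: le_trans (inv_lipschitz m0 p1 q1) _; rewrite ler_wpM2l.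
have pq_ge0 := normr_ge0 (p - q).
apply: vec_norm_le.
- by rewrite mulr_ge0// !addr_ge0// ltW.
- rewrite mxE [X in _ + X]mxE !vcons0; apply: le_trans inv_le _.
  rewrite ler_wpM2r//; lra.
- move=> i; rewrite mxE [X in _ + X]mxE !vconsS !mxE.
  set x := p 0 ord0 in inv_le *; set y := q 0 ord0 in q1 inv_le *.
  set u := p 0 (lift ord0 i); set w := q 0 (lift ord0 i).
  have uw : `|u - w| <= `|p - q|.
    by have := rv_coord_le (p - q) (lift ord0 i); rewrite !mxE.
  have um : `|u| <= m by exact: le_trans (rv_coord_le _ _) p2.
  have ym : `|y^-1| <= m.
    rewrite normfV -[m]invrK lef_pV2 ?posrE ?invr_gt0//.
    by rewrite (lt_le_trans _ q1)// invr_gt0.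
  rewrite (_ : x^-1 * u - y^-1 * w = u * (x^-1 - y^-1) + y^-1 * (u - w)); last by ring.
  apply: le_trans (ler_normD _ _) _; rewrite !normrM.
  apply: (@le_trans _ _ (m * (m ^+ 2 * `|p - q|) + m * `|p - q|)).
    by apply: lerD; apply: ler_pM.
  rewrite mulrA -exprS -mulrDl ler_wpM2r//; lra.
Qed.

(* The index lists a dilation factor, a translation vector and the box in which
   the projective map is Lipschitz. *)
Definition spread_piece (B : set 'rV[R]_n.+1)
    (i : nat * 'rV[rat]_n.+1 * nat) : set 'rV[R]_n.+1 :=
  let f p := i.1.1.+1%:R *: p + map_mx ratr i.1.2 in
  (projective_inv \o f) @` (B `&` f @^-1` box i.2).

Definition spread (B : set 'rV[R]_n.+1) : set 'rV[R]_n.+1 :=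
  \bigcup_i spread_piece B i.

Lemma null_cover_spread s (B : set 'rV[R]_n.+1) : 0 < s ->
  null_cover (@norm_dist R 'rV[R]_n.+1) s B ->
  null_cover (@norm_dist R 'rV[R]_n.+1) s (spread B).
Proof.
move=> s0 nB; apply: (null_cover_bigcup_count (0%N, 0, 0%N) s0) => -[[l z] j].
rewrite /spread_piece; set f := fun p => _.
have nBj : null_cover (@norm_dist R 'rV[R]_n.+1) s (B `&` f @^-1` box j).
  exact: null_coverS nB.
pose c : R := (j.+1%:R ^+ 3 + j.+1%:R ^+ 2 + j.+1%:R) * l.+1%:R.
have c0 : 0 < c by rewrite mulr_gt0 ?ltr0n// !addr_gt0 ?exprn_gt0 ?ltr0n.
apply: (null_cover_lipschitz s0 c0 _ nBj) => p q [_ pj] [_ qj].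
rewrite /norm_dist /c -mulrA; apply: le_trans (projective_inv_lipschitz pj qj) _.
rewrite ler_wpM2l ?addr_ge0 ?exprn_ge0 ?ler0n//.
rewrite /f /= opprD addrACA subrr addr0 -scalerBr normrZ.
by rewrite ger0_norm ?ler0n.
Qed.

(** The unit segment of [B] in direction [(1, v)] is dilated and translated by a rational vector
    until it contains the part over [[- K, K]] of a line [(x, a + x v)] with [a] near [a0];
    [projective_inv] turns this part, off [x = 0], into the points [(t, v + t a)] with
    [1 / K <= |t|]. *)
Lemma spread_dense (B : set 'rV[R]_n.+1) : besicovitch B ->
  forall (k : nat) v a0 (e : R), 0 < e ->
  exists2 a, `|a0 - a| < e &
    forall t : R, k.+1%:R^-1 <= `|t| <= k.+1%:R -> spread B (line_pt t (a, v)).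
Proof.
move=> bB k v a0 e e0; set K : R := k.+1%:R.
have K0 : 0 < K by rewrite ltr0n.
pose L := enorm (vcons 1 v).
have L0 : 0 < L.
  apply: lt_le_trans (norm_le_enorm _); rewrite (@lt_le_trans _ _ 1)//.
  by have := rv_coord_le (vcons 1 v) ord0; rewrite vcons0 normr1.
have [|p Bp] := bB (L^-1 *: vcons 1 v).
  by rewrite enormZ gtr0_norm ?invr_gt0// mulVf ?gt_eqF.
(* A unit step along [(1, v)] advances the first coordinate by [1 / L], so the segment dilated by
   [l.+1] advances it by at least [2 * K + 1]. *)
pose l := Num.truncn (L * (2 * K + 1)).
have lP : L * (2 * K + 1) <= l.+1%:R by rewrite ltW// truncnS_gt.
have l0 : 0 < l.+1%:R :> R by rewrite ltr0n.
(* The translated starting point has first coordinate [c] between [- K - 1] and [- K], so the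
   dilated segment reaches over all of [[- K, K]]. *)
have [|q0] := @rat_in_itvoo R (- K - 1 - l.+1%:R * p 0 ord0)
  (- K - l.+1%:R * p 0 ord0); first lra.
rewrite in_itv /= => q0P.
pose c := l.+1%:R * p 0 ord0 + ratr q0.
have cP : - K - 1 < c < - K by rewrite /c; lra.
(* The intercept at [x = 0] of the translated line is brought within [e / 2] of [a0], coordinate by
   coordinate. *)
have /choice[q qP] : forall i : 'I_n, exists q : rat,
    `|a0 0 i - (l.+1%:R * p 0 (lift ord0 i) + ratr q - c * v 0 i)| < e / 2.
  move=> i; pose b := a0 0 i - l.+1%:R * p 0 (lift ord0 i) + c * v 0 i.
  have [|q] := @rat_in_itvoo R (b - e / 2) (b + e / 2); first lra.
  rewrite in_itv /= /b => qP; exists q; rewrite ltr_distl; lra.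
pose z : 'rV[rat]_n.+1 := \row_i (if unlift ord0 i is Some j then q j else q0).
pose a : 'rV[R]_n := \row_i (l.+1%:R * p 0 (lift ord0 i) + ratr (q i) - c * v 0 i).
exists a.
  apply: (@le_lt_trans _ _ (e / 2)); last by lra.
  apply/rv_norm_leP; first by rewrite divr_ge0// ltW.
  by move=> i; rewrite !mxE ltW.
move=> t /andP[Kt tK].
have t0 : t != 0 by rewrite -normr_gt0 (lt_le_trans _ Kt)// invr_gt0.
pose x := t^-1.
have xK : `|x| <= K by rewrite normfV -[K]invrK lef_pV2 ?posrE ?invr_gt0 ?normr_gt0.
have Kx : K^-1 <= `|x| by rewrite normfV lef_pV2 ?posrE ?normr_gt0.
have xc : 0 <= x - c <= 2 * K + 1.
  by move: xK cP; rewrite ler_norml; lra.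
pose P := p + (L * (x - c) / l.+1%:R) *: (L^-1 *: vcons 1 v).
have BP : B P.
  have /andP[xc0 xc1] := xc.
  apply: Bp; apply/andP; split; first by rewrite divr_ge0 ?ler0n// mulr_ge0// ltW.
  by rewrite ler_pdivrMr// mul1r (le_trans _ lP)// ler_pM2l.
(* Large enough for the box: the first coordinate is at most [K] and at least [1 / K] in absolute
   value, the others are at most the second summand. *)
pose j := Num.truncn (K + (`|a| + K * `|v|)).
have jP : K + (`|a| + K * `|v|) < j.+1%:R by exact: truncnS_gt.
have av0 : 0 <= `|a| + K * `|v| by rewrite addr_ge0// mulr_ge0// ltW.
have fP : l.+1%:R *: P + map_mx ratr z = vcons x (a + x *: v).
  apply/rowP => i; rewrite /P /z.
  rewrite mxE [X in X + _]mxE [X in _ * X]mxE [X in (_ + X)]mxE.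
  rewrite [X in _ * (_ + X) + _]mxE [X in _ * (_ + _ * X) + _]mxE.
  rewrite [X in ratr X]mxE.
  case: (unliftP ord0 i) => [i'|] ->; rewrite ?liftK ?unlift_none.
    rewrite !vconsS ?mxE; field; rewrite !gt_eqF//.
  rewrite !vcons0 /c; field; rewrite !gt_eqF//.
exists (l, z, j) => //; exists P => /=.
  split => //; rewrite /preimage /= fP; split.
    rewrite vcons0 (le_trans _ Kx)// lef_pV2 ?posrE ?ltr0n//; lra.
  apply: vec_norm_le; first by rewrite ler0n.
    by rewrite vcons0; lra.
  move=> i; rewrite vconsS mxE [X in _ + X]mxE.
  apply: le_trans (ler_normD _ _) _.
  have : `|a 0 i| <= `|a| by exact: rv_coord_le.
  have : `|x * v 0 i| <= K * `|v|.
    by rewrite normrM; apply: ler_pM => //; exact: rv_coord_le.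
  lra.
rewrite /= fP /projective_inv vcons0 vtail_vcons invrK /line_pt /=.
by rewrite scalerDr scalerA divff ?scale1r 1?addrC.
Qed.

End projective.

(** * Hausdorff dimension of Besicovitch sets *)

Section besicovitch_dimension.
Context {R : realType} {n : nat}.
Implicit Types (B : set 'rV[R]_n.+1) (K : set ('rV[R]_n * 'rV[R]_n)).

Definition lines_union K : set 'rV[R]_n.+1 :=
  \bigcup_(av in K) range (line_pt^~ av).

(** A tube lemma: the [t] in question form a compact set, so an open condition on [line_pt t av]
    that holds for all of them persists for nearby [av]. *)
Lemma open_lines_in (U : set 'rV[R]_n.+1) (k : nat) : open U ->
  open [set av | forall t : R, k.+1%:R^-1 <= `|t| <= k.+1%:R -> U (line_pt t av)].
Proof.
move=> oU; rewrite openE => av /= avU; rewrite /interior.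
pose T := [set t : R | k.+1%:R^-1 <= `|t| <= k.+1%:R].
have cT : compact T.
  apply: (subclosed_compact _ (@segment_compact R (- k.+1%:R) k.+1%:R)); last first.
    by move=> t /= /andP[_]; rewrite in_itv/= -ler_norml.
  have -> : T = (fun t : R => `|t|) @^-1` `[k.+1%:R^-1, k.+1%:R]%classic.
    by apply/seteqP; split => t; rewrite /T /= in_itv.
  by apply: preimage_closed => [t _|]; [exact: norm_continuous|exact: itv_closed].
apply: ((compact_near_coveringP _).1 cT _ (nbhs av) (fun av t => U (line_pt t av))).
move=> t Tt; apply: (@line_pt_continuous R n (t, av)).
by apply: open_nbhs_nbhs; split => //; exact: avU.
Qed.

(** [O k] collects the lines whose points over [1 / k.+1 <= |t| <= k.+1] stay in an open set [U k]
    around [spread B] of cover sum at most [1 / k.+1]. It is open and, by [spread_dense], dense in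
    every section, so [compact_selection] applies. *)
Lemma besicovitch_lines s B : 0 < s ->
  null_cover (@norm_dist R 'rV[R]_n.+1) s B -> besicovitch B ->
  exists K, [/\ compact K,
    forall v, @unit_cube R n v -> exists a, K (a, v) &
    null_cover (@norm_dist R 'rV[R]_n.+1) s
      (lines_union K `&` [set p | p 0 ord0 != 0])].
Proof.
move=> s0 nB bB; have nS := null_cover_spread s0 nB.
have /choice[U UP] : forall k : nat, exists U : set 'rV[R]_n.+1,
    [/\ open U, spread B `<=` U & exists (V : nat -> set 'rV[R]_n.+1) (r : nat -> R),
    [/\ forall i, 0 < r i, forall i x y, V i x -> V i y -> `|x - y| <= r i,
        U = \bigcup_i V i & (\sum_(i <oo) (r i `^ s)%:E <= (k.+1%:R^-1)%:E)%E]].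
  move=> k; have k0 : 0 < k.+1%:R^-1 :> R by rewrite invr_gt0.
  have [V [r [r0 Vr BV rs oV]]] := null_cover_open s0 k0 nS.
  exists (\bigcup_i V i); split => //; first by apply: bigcup_open => i _; exact: oV.
  by exists V, r.
(* Radius 2 for the intercepts leaves a unit ball around [(0, v)] for every [v] in the unit cube. *)
pose C0 : set ('rV[R]_n * 'rV[R]_n) := closed_ball 0 1 `*` closed_ball 0 2.
have cball (r : R) : 0 < r -> compact (closed_ball (0 : 'rV[R]_n) r).
  move=> r0; apply: bounded_closed_compact; last exact: closed_ball_closed.
  exists r; split; first exact: num_real.
  move=> M rM x; rewrite closed_ballE// /closed_ball_ /= sub0r normrN => h.
  exact: le_trans h (ltW rM).
have cC0 : compact C0 by apply: compact_setX; exact: cball.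
pose O k : set ('rV[R]_n * 'rV[R]_n) := [set av | forall t : R,
  k.+1%:R^-1 <= `|t| <= k.+1%:R -> U k (line_pt t av)].
have [] := @compact_selection R _ _ _ (@compact_unit_cube R n) O C0
    (compact_closed (@norm_hausdorff _ _) cC0) cC0.
- move=> v Qv; exists 0; apply/nbhs_ballP; exists 1 => //=.
  move=> [a w] [/= a1 w1]; split => /=.
    exact: subset_closed_ball.
  rewrite closed_ballE// /closed_ball_ /= sub0r normrN.
  move: w1; rewrite -ball_normE /= => w1.
  have v1 : `|v| <= 1.
    by apply/rv_norm_leP => // i; have /andP[v0 v1] := Qv i; rewrite ger0_norm.
  rewrite -[w](subrK v) addrC -[w - v]opprB.
  by apply: le_trans (ler_normB _ _) _; lra.
- by move=> k; apply: open_lines_in; have [] := UP k.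
- move=> k v a0 e _ e0.
  have [a aa0 aP] := spread_dense bB k v a0 e0.
  exists a; first by rewrite -ball_normE.
  by move=> t tk; have [_ + _] := UP k; apply; exact: aP.
move=> K [cK KO KQ]; exists K; split => //.
pose A (j : nat) := lines_union K `&` [set p | j.+1%:R^-1 <= `|p 0 ord0| <= j.+1%:R].
apply: (@null_coverS _ _ _ _ _ (\bigcup_j A j)).
  move=> p [Kp /= p0].
  pose x := `|p 0 ord0|; have x0 : 0 < x by rewrite normr_gt0.
  pose j := Num.truncn (x + x^-1).
  have jP : x + x^-1 < j.+1%:R by exact: truncnS_gt.
  have xV0 : 0 < x^-1 by rewrite invr_gt0.
  exists j => //; split => //=; rewrite -/x; apply/andP; split; last by lra.
  by rewrite -[x]invrK lef_pV2 ?posrE ?invr_gt0// ?ltr0n//; lra.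
apply: null_cover_bigcup => // j e e0.
(* [i] makes the cover cheaper than [e]; [j] makes the range of [t] controlled by [U k] contain that
   of [A j]. *)
pose i := Num.truncn e^-1; pose k := maxn i j.
have ke : k.+1%:R^-1 <= e.
  rewrite -[e]invrK lef_pV2 ?posrE ?invr_gt0//.
  apply: (@le_trans _ _ i.+1%:R); first by rewrite ltW// truncnS_gt.
  by rewrite ler_nat ltnS leq_maxl.
have [_ _ [V [r [r0 Vr UV rs]]]] := UP k.
exists V, r; split => //; last by apply: le_trans rs _; rewrite lee_fin.
move=> p [[av Kav [t _ <-]]]; rewrite /= vcons0 => /andP[t1 t2].
rewrite -UV; apply: (KO av Kav k Logic.I).
have jk : j.+1%:R <= k.+1%:R :> R by rewrite ler_nat ltnS leq_maxr.
rewrite (le_trans t2)// andbT (le_trans _ t1)//.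
by rewrite lef_pV2 ?posrE.
Qed.

(** Restricting [t] to [[- j, j]] gives a continuous image of a compact set, so the union is
    sigma-compact. *)
Lemma lines_union_borel K : compact K -> is_borel (lines_union K).
Proof.
move=> cK.
pose F (j : nat) := (fun p : R * ('rV[R]_n * 'rV[R]_n) => line_pt p.1 p.2) @`
  (`[- j%:R, j%:R]%classic `*` K).
have -> : lines_union K = \bigcup_j F j.
  apply/seteqP; split => p.
    move=> [av Kav [t _ <-]].
    exists (Num.truncn `|t|).+1 => //; exists (t, av) => //; split => //=.
    by rewrite in_itv/= -ler_norml ltW// truncnS_gt.
  by move=> [j _ [[t av] [/= _ Kav] <-]]; exists av => //; exists t.
apply: sigma_algebra_bigcup => j.
rewrite -[F j]setCK; apply: sigma_algebraC; apply: sub_sigma_algebra => /=.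
apply: closed_openC; apply: compact_closed; first exact: norm_hausdorff.
apply: continuous_compact.
  by apply: continuous_subspaceT; exact: line_pt_continuous.
by apply: compact_setX => //; exact: segment_compact.
Qed.

Lemma line_pt_line (av : 'rV[R]_n * 'rV[R]_n) :
  is_line (range (line_pt^~ av)) /\ non_vertical (range (line_pt^~ av)).
Proof.
split.
  exists (vcons 0 av.2), (vcons 1 av.1); split.
    apply/eqP => /rowP/(_ ord0); rewrite vcons0 mxE => /eqP.
    by rewrite oner_eq0.
  apply/seteqP; split => p [t _ <-]; exists t => //;
    by rewrite /line_pt vcons_linear add0r mulr1.
apply/seteqP; split => // t _; exists (line_pt t av); first by exists t.
by rewrite /line_pt vcons0.
Qed.

(* The slice of the union at t = 0 is the set of all v with (a, v) in K. *)
Lemma lines_union_dim_ge K : (0 < n)%N ->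
  (forall v, @unit_cube R n v -> exists a, K (a, v)) ->
  (n%:R%:E <= hausdorff_dim (@euclidean_dist R n.+1) (lines_union K))%E.
Proof.
move=> n0 KQ; rewrite leNgt; apply/negP => h.
have n0R : 0 < n%:R :> R by rewrite ltr0n.
have /(null_cover_euclidean _ n0R) := null_cover_of_dim_lt (@euclidean_dist_ge0 R n.+1) n0R h.
move=> nK; apply: (@unit_cube_not_null R n n%:R); first by rewrite n0R lexx.
apply: (@null_coverS _ _ _ _ _ (@vtail R n @` lines_union K)).
  move=> v /KQ[a Kav]; exists (line_pt 0 (a, v)); first by exists (a, v) => //; exists 0.
  by rewrite /line_pt vtail_vcons scale0r addr0.
apply: null_cover_lipschitz n0R (@ltr01 R) _ nK => p q _ _.
rewrite mul1r; apply/rv_norm_leP; first exact: norm_dist_ge0.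
by move=> i; rewrite !mxE; have := rv_coord_le (p - q) (lift ord0 i); rewrite !mxE.
Qed.

Lemma ess_sup_slice_dim_le (q : R) (A : set 'rV[R]_n.+1) : 0 < q ->
  null_cover (@norm_dist R 'rV[R]_n.+1) (q + 1) (A `&` [set p | p 0 ord0 != 0]) ->
  (ess_sup_slice_dim A <= q%:E)%E.
Proof.
move=> q0 nA; apply: ge_ereal_sup => x [->|]; first by rewrite lee_fin ltW.
move=> [q' [q'0 Hq'] <-{x}]; rewrite lee_fin leNgt; apply/negP => qq'.
suff : hausdorff_measure (@rdist R) 1 [set t : R | (q'%:E <
    hausdorff_dim (@euclidean_dist R n) (slice A t))%E] = 0%E.
  by move=> h; rewrite h ltxx in Hq'.
apply: hausdorff_of_null_cover => //; first exact: rdist_ge0.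
(* The slice at [t = 0] may be large, but a single point has measure zero; the other exceptional [t]
   come from [null_cover_slices]. *)
pose N (i : bool) : set R := if i then [set 0] else [set t | ~ null_cover (@norm_dist R _) q
  (slice (A `&` [set p | p 0 ord0 != 0]) t)].
apply: (@null_coverS _ _ _ _ _ (\bigcup_i N i)); last first.
  apply: (null_cover_bigcup_count true) => // -[] /=; last exact: null_cover_slices.
  by apply: null_cover_of_lebesgue; exact: lebesgue_measure_set1.
move=> t /= tq; have [->|t0] := eqVneq t 0; first by exists true.
exists false => //= nAt; move: tq; apply/negP; rewrite -leNgt.
apply: (@le_trans _ _ q%:E); last by rewrite lee_fin ltW.
apply: hausdorff_dim_le_null_cover => //; first exact: euclidean_dist_ge0.
apply/null_cover_euclidean => //; apply: null_coverS nAt => x Ax; split => //=.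
by rewrite vcons0.
Qed.

(** Projecting the unit segment in the first coordinate direction gives a copy of [[0, 1]]. This
    settles the plane, where the slice exponent [s - 1] would not be positive. *)
Lemma besicovitch_not_null1 B : besicovitch B ->
  ~ null_cover (@norm_dist R 'rV[R]_n.+1) 1 B.
Proof.
move=> bB nB; have [a aB] := bB _ (@enorm_vcons10 R n).
apply: (@unit_cube_not_null R 1 1); first by rewrite ltr01 lexx.
pose f (p : 'rV[R]_n.+1) : 'rV[R]_1 := (p 0 ord0 - a 0 ord0)%:M.
apply: (@null_coverS _ _ _ _ _ (f @` B)).
  move=> x /(_ 0) x01; exists (a + x 0 0 *: vcons 1 0); first exact: aB.
  have -> : f (a + x 0 0 *: vcons 1 0) = (a 0 ord0 + x 0 0 - a 0 ord0)%:M.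
    by rewrite /f mxE [X in _ + X - _]mxE vcons0 mulr1.
  apply/rowP => i; rewrite ord1 mxE eqxx mulr1n.
  by rewrite addrAC subrr add0r.
apply: null_cover_lipschitz (@ltr01 R) (@ltr01 R) _ nB => p q _ _.
rewrite mul1r; apply/rv_norm_leP; first exact: norm_dist_ge0.
move=> i; rewrite ord1 /f !mxE eqxx !mulr1n opprB addrA subrK.
by have := rv_coord_le (p - q) ord0; rewrite !mxE.
Qed.

Lemma besicovitch_dim_ge B : (0 < n)%N -> fubini_for_lines R n ->
  besicovitch B -> ((n.+1%:R - 1)%:E <= hausdorff_dim (@euclidean_dist R n.+1) B)%E.
Proof.
move=> n0 Fn bB; rewrite -natr1 addrK leNgt; apply/negP => dB.
have [n1|n1] := leqP n 1.
  have En : n = 1%N by apply/eqP; rewrite eqn_leq n1.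
  apply: (besicovitch_not_null1 bB); apply/(null_cover_euclidean _ ltr01).
  apply: null_cover_of_dim_lt => //; first exact: euclidean_dist_ge0.
  by rewrite [X in (_ < X%:E)%E](_ : _ = n%:R)// En.
have n1R : 1 < n%:R :> R by rewrite ltr1n.
have [_ [s0 [s00 HB] <-]] := ereal_inf_lt dB; rewrite lte_fin => s0n.
(* [s] exceeds 1 to make the slice exponent [s - 1] positive, is at least [s0] to keep [B] null, and
   stays below [n] for the contradiction. *)
pose s := (Num.max s0 1 + n%:R) / 2.
have mn : Num.max s0 1 < n%:R by rewrite gt_max s0n n1R.
have s1 : 1 < s.
  have : 1 <= Num.max s0 1 by rewrite le_max lexx orbT.
  by rewrite /s; lra.
have s0s : s0 <= s.
  have : s0 <= Num.max s0 1 by rewrite le_max lexx.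
  by rewrite /s; lra.
have sn : s < n%:R by rewrite /s; lra.
have s_gt0 : 0 < s by lra.
have nB : null_cover (@norm_dist R 'rV[R]_n.+1) s B.
  apply/null_cover_euclidean => //.
  by apply: null_cover_of_hausdorff HB; rewrite ?s00//; exact: euclidean_dist_ge0.
have [K [cK KQ nK]] := besicovitch_lines s_gt0 nB bB.
have dK := lines_union_dim_ge n0 KQ.
have q0 : 0 < s - 1 by lra.
have : (ess_sup_slice_dim (lines_union K) <= (s - 1)%:E)%E.
  by apply: ess_sup_slice_dim_le => //; rewrite subrK.
have EK : lines_union K = \bigcup_(P in [set range (line_pt^~ av) | av in K]) P.
  by rewrite bigcup_image.
have := Fn [set range (line_pt^~ av) | av in K]; rewrite /= -EK => FK.
rewrite FK in dK.
(* The contradiction: [n] is at most the dimension of the union, which by F(m) is the essential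
   supremum plus 1, hence at most [s < n]. *)
- move=> h; have {h} : (n%:R%:E <= (s - 1)%:E + 1)%E.
    by apply: le_trans dK _; rewrite leeD2r.
  by rewrite -EFinD subrK lee_fin leNgt sn.
- have [a Ka] : exists a, K (a, 0) by apply: KQ => i; rewrite mxE lexx ler01.
  by exists (range (line_pt^~ (a, 0))); exists (a, 0).
- by move=> _ [av _ <-]; exact: line_pt_line.
- exact: lines_union_borel.
Qed.

End besicovitch_dimension.

(** * Powers of Besicovitch sets and box dimension *)

Section finite_covers.
Context {R : realType} {T : Type}.
Variable d : T -> T -> R.

(** One [delta] serves all sets of the finite cover; the indices from [#|F|] on carry the empty set,
    with positive radii of small total weight. *)
Lemma null_cover_finite (s : R) (A : set T) : 0 < s ->
  (forall e : R, 0 < e -> exists (F : finType) (U : F -> set T) (delta : R),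
    [/\ 0 < delta, forall i x y, U i x -> U i y -> d x y <= delta,
        A `<=` \bigcup_i U i & #|F|%:R * delta `^ s <= e]) ->
  null_cover d s A.
Proof.
move=> s0 h e e0; have e20 : 0 < e / 2 by rewrite divr_gt0.
have [F [U [delta [delta0 Ud AU Fe]]]] := h _ e20.
pose tiny i := ((e / 2) / (2 ^ i.+1)%:R)%R.
have tiny0 i : 0 < tiny i by rewrite !divr_gt0// ltr0n expn_gt0.
pose V (i : nat) : set T := if insub i is Some j then U (enum_val (j : 'I_#|F|)) else set0.
pose f (i : nat) : \bar R := if (i < #|F|)%N then (delta `^ s)%:E else 0%E.
have f0 i : (0 <= f i)%E by rewrite /f; case: ifP => // _; rewrite lee_fin powR_ge0.
exists V, (fun i => if (i < #|F|)%N then delta else tiny i `^ s^-1); split.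
- by move=> i; case: ifP => // _; exact: powR_gt0.
- move=> i x y; rewrite /V; case: insubP => [j -> _|//]; exact: Ud.
- move=> x /AU[i _ Ux]; exists (enum_rank i) => //.
  by rewrite /V valK enum_rankK.
- apply: (@le_trans _ _ (\sum_(i <oo) (f i + (tiny i)%:E))%E).
    apply: lee_nneseries => i; first by move=> _ _; rewrite lee_fin powR_ge0.
    move=> _; rewrite /f; case: ifP => _; first by rewrite leeDl// lee_fin ltW.
    by rewrite add0e powR_invK ?(ltW (tiny0 i))// gt_eqF.
  apply: le_trans (epsilon_trick _ _ _) _ => //; first by rewrite divr_ge0// ltW.
  rewrite [leRHS](_ : _ = (e/2)%:E + (e/2)%:E)%E; last by rewrite -EFinD -splitr.
  rewrite leeD2r// (nneseries_split 0 #|F|)// add0n.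
  rewrite [X in (_ + X)%E]eseries0 ?adde0; last first.
    by move=> i Fi _; rewrite /f ltnNge Fi.
  rewrite big_mkord (eq_bigr (fun=> (delta `^ s)%:E)).
    by rewrite sumEFin sumr_const card_ord lee_fin -[leLHS]mulr_natl.
  by move=> i _; rewrite /f ltn_ord.
Qed.

Lemma covering_number_ge0 (delta : R) (A : set T) :
  (0 <= covering_number d delta A)%E.
Proof. by apply: le_ereal_inf_tmp => _ [k _ <-]; rewrite lee_fin. Qed.

(** For [delta < 1] the number [- ln delta] is positive, so the bound on the quotient of logarithms
    exponentiates; strictness of the inequality yields an actual cover below the infimum. *)
Lemma covers_of_upper_box_dim (A : set T) (D : R) :
  (upper_box_dim d A < D%:E)%E ->
  exists2 delta0 : R, 0 < delta0 & forall delta, 0 < delta < delta0 ->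
    exists (k : nat) (U : 'I_k -> set T),
      [/\ forall i x y, U i x -> U i y -> d x y <= delta,
          A `<=` \bigcup_i U i & k%:R <= delta `^ (- D)].
Proof.
move=> /ereal_inf_lt[_ [V nV <-] VD].
have : \forall delta \near (0 : R)^'+, V delta by [].
move=> /nbhs_right0P; rewrite near_withinE => /nbhs_ballP[r /= r0 rV].
exists (Num.min r 1); first by rewrite lt_min r0 ltr01.
move=> delta /andP[delta0]; rewrite lt_min => /andP[dr d1].
have Vd : V delta.
  rewrite -[delta]add0r; apply: rV => //.
  by rewrite -ball_normE /= sub0r normrN gtr0_norm.
have c0 : 0 < (- ln delta)^-1 by rewrite invr_gt0 oppr_gt0 ln_lt0// delta0.
have hD : (lne (covering_number d delta A) * ((- ln delta)^-1)%:E < D%:E)%E.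
  by apply: le_lt_trans VD; apply: ereal_sup_ubound; exists delta.
have : (covering_number d delta A < (delta `^ (- D))%:E)%E.
  rewrite ltNge; apply/negP => le; move: hD; apply/negP; rewrite -leNgt.
  have p0 : 0 < delta `^ (- D) by exact: powR_gt0.
  have : (lne (delta `^ (- D))%:E <= lne (covering_number d delta A))%E.
    rewrite lee_lne// in_itv/= ?leey ?andbT ?covering_number_ge0//.
    by rewrite lee_fin ltW.
  rewrite lne_EFin// ln_powR mulNr -mulrN => h.
  apply: le_trans (lee_wpmul2r _ h); last by rewrite lee_fin ltW.
  by rewrite -EFinM lee_fin mulfK// gt_eqF// oppr_gt0 ln_lt0// delta0.
move=> /ereal_inf_lt[_ [k [U [dU AU]] <-]]; rewrite lte_fin => kd.
exists k, U; split => //; last exact: ltW.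
move=> i x y Ux Uy; rewrite -lee_fin; apply: le_trans (dU i).
exact: le_diam.
Qed.

End finite_covers.

Section power.
Context {R : realType} {k n : nat}.
Notation K := k.+1.
Notation m := n.+1.

Definition block (p : 'rV[R]_(K * m)) (i : 'I_K) : 'rV[R]_m := row i (vec_mx p).

Definition power_set (B : set 'rV[R]_m) : set 'rV[R]_(K * m) :=
  [set p | forall i, B (block p i)].

Lemma blockE (p : 'rV[R]_(K * m)) i j : block p i 0 j = p 0 (mxvec_index i j).
Proof. by rewrite /block !mxE. Qed.

Lemma power_norm_le (p : 'rV[R]_(K * m)) c : 0 <= c ->
  (forall i, `|block p i| <= c) -> `|p| <= c.
Proof.
move=> c0 h; apply/rv_norm_leP => // l; case/mxvec_indexP: l => i j.
by rewrite -blockE (le_trans _ (h i))//; exact: rv_coord_le.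
Qed.

Lemma block_norm_le (p : 'rV[R]_(K * m)) i : `|block p i| <= `|p|.
Proof. by apply/rv_norm_leP => // j; rewrite blockE; exact: rv_coord_le. Qed.

Lemma block_enorm_le (p : 'rV[R]_(K * m)) i : enorm (block p i) <= enorm p.
Proof.
rewrite /enorm ler_wsqrtr//.
have -> : \sum_l p 0 l ^+ 2 = \sum_i \sum_j p 0 (mxvec_index i j) ^+ 2.
  rewrite pair_bigA (reindex _ (curry_mxvec_bij _ _)) /=.
  by apply: eq_bigr => -[i' j] _.
rewrite (bigD1 i)//= -[leLHS]addr0 lerD//.
  by apply: ler_sum => j _; rewrite blockE.
by apply: sumr_ge0 => i' _; apply: sumr_ge0 => j _; exact: sqr_ge0.
Qed.

Lemma enorm_eq0 l (x : 'rV[R]_l) : enorm x = 0 -> x = 0.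
Proof.
by move=> x0; apply/eqP; rewrite -normr_le0; rewrite -x0; exact: norm_le_enorm.
Qed.

(** Each block of a unit vector has norm at most 1, so the segment it spans fits into a unit segment
    of [B]; a zero block is served by any point of [B]. The starting points of the blocks are
    independent. *)
Lemma besicovitch_power (B : set 'rV[R]_m) : besicovitch B ->
  besicovitch (power_set B).
Proof.
move=> bB e e1.
have [b Bb] : exists b, B b.
  have [a aB] := bB _ (@enorm_vcons10 R n).
  by exists (a + 0 *: vcons 1 0); apply: aB; rewrite lexx ler01.
have /choice[a aP] : forall i, exists a, forall s : R, 0 <= s <= 1 ->
    B (a + s *: block e i).
  move=> i; have c1 : enorm (block e i) <= 1 by rewrite -e1; exact: block_enorm_le.
  have [/enorm_eq0 c0|c0] := eqVneq (enorm (block e i)) 0.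
    by exists b => s _; rewrite c0 scaler0 addr0.
  have c_gt0 : 0 < enorm (block e i) by rewrite lt_def c0 enorm_ge0.
  have [|a aB] := bB ((enorm (block e i))^-1 *: block e i).
    by rewrite enormZ gtr0_norm ?invr_gt0// mulVf.
  exists a => s /andP[s0 s1].
  have := aB (s * enorm (block e i)); rewrite scalerA mulfK//; apply.
  by rewrite mulr_ge0 ?(ltW c_gt0)//= mulr_ile1// ltW.
exists (mxvec (\matrix_(i, j) a i 0 j)) => s s01 i.
rewrite (_ : block _ i = a i + s *: block e i); first exact: aP.
apply/rowP => j; rewrite blockE mxE mxvecE !mxE.
by rewrite -[RHS]/(_ + _); congr (_ + _ * _).
Qed.

(** Products of [K] sets from a cover of [A] keep the diameter bound [delta] in the sup norm. Their
    number is at most the power of [delta] with exponent [- (K * D)], so their total weight is at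
    most that with exponent [g = s - K * D > 0]. *)
Lemma null_cover_power_bounded (A : set 'rV[R]_m) (D s : R) :
  0 < s -> K%:R * D < s -> (upper_box_dim (@euclidean_dist R m) A < D%:E)%E ->
  null_cover (@norm_dist R 'rV[R]_(K * m)) s (power_set A).
Proof.
move=> s0 Ds AD; have [delta0 delta0_gt0 hA] := covers_of_upper_box_dim AD.
apply: null_cover_finite => // e e0.
pose g := s - K%:R * D; have g0 : 0 < g by rewrite subr_gt0.
(* The first bound puts [delta] strictly below [delta0], the second makes its [g]-th power at most
   [e]. *)
pose delta := Num.min (delta0 / 2) (e `^ g^-1).
have dpos : 0 < delta by rewrite lt_min divr_gt0//= powR_gt0.
have ddelta0 : delta < delta0.
  by apply: (@le_lt_trans _ _ (delta0 / 2)); [rewrite ge_min lexx|lra].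
have [N [U [Ud AU Nd]]] := hA delta (introT andP (conj dpos ddelta0)).
exists {ffun 'I_K -> 'I_N}, (fun f : {ffun 'I_K -> 'I_N} =>
  [set p | forall i, U (f i) (block p i)]), delta.
split => //.
- move=> f p q fp fq; apply: power_norm_le; first exact: ltW.
  move=> i; rewrite (_ : block (p - q) i = block p i - block q i); last first.
    by apply/rowP => j; rewrite blockE [RHS]mxE [X in _ = _ + X]mxE !blockE !mxE.
  apply: le_trans (norm_le_enorm _) _.
  exact: Ud (fp i) (fq i).
- move=> p Ap.
  have /choice[f fP] : forall i, exists j, U j (block p i).
    by move=> i; have [j _ Uj] := AU _ (Ap i); exists j.
  by exists [ffun i => f i] => // i; rewrite ffunE.
- rewrite card_ffun !card_ord natrX.
  apply: (@le_trans _ _ ((delta `^ (- D)) ^+ K * delta `^ s)).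
    rewrite ler_wpM2r ?powR_ge0// lerXn2r ?nnegrE ?ler0n ?powR_ge0//.
  rewrite -powR_mulrn ?powR_ge0// -powRrM -powRD; last by rewrite (gt_eqF dpos) implybT.
  rewrite (_ : - D * K%:R + s = g); last by rewrite /g; ring.
  apply: (@le_trans _ _ ((e `^ g^-1) `^ g)); last by rewrite powR_invK ?(ltW e0) ?gt_eqF.
  apply: ge0_ler_powR; rewrite ?nnegrE; [exact: ltW|exact: ltW|exact: powR_ge0|].
  by rewrite ge_min lexx orbT.
Qed.

(** All blocks of a point are bounded by its norm, so the powers of the bounded parts [A r] exhaust
    the power of [B]. *)
Lemma null_cover_power (B : set 'rV[R]_m) (D s : R) :
  0 < s -> K%:R * D < s ->
  (upper_minkowski_dim (@euclidean_dist R m) B < D%:E)%E ->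
  null_cover (@norm_dist R 'rV[R]_(K * m)) s (power_set B).
Proof.
move=> s0 Ds BD.
pose A (r : nat) := B `&` [set x | `|x| <= r%:R].
apply: (@null_coverS _ _ _ _ _ (\bigcup_r power_set (A r))).
  move=> p Bp; exists (Num.truncn `|p|).+1 => // i; split; first exact: Bp.
  by rewrite /= (le_trans (block_norm_le p i))// ltW// truncnS_gt.
apply: null_cover_bigcup => // r; apply: (@null_cover_power_bounded _ D) => //.
apply: le_lt_trans BD; apply: ereal_sup_ubound; exists (A r) => //; split.
  by move=> x [].
apply: (@le_lt_trans _ _ (m%:R * (r%:R + r%:R))%:E); last exact: ltry.
apply: diam_le => x y [_ /= xr] [_ /= yr].
apply: le_trans (enorm_le_norm _) _; rewrite ler_wpM2l//.
by apply: le_trans (ler_normB _ _) _; exact: lerD.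
Qed.

End power.

(** * Upper Minkowski dimension of Besicovitch sets *)

Section box_dimension.
Context {R : realType} {n : nat}.
Notation m := n.+1.

Lemma covering_number_le (A : set 'rV[R]_m) (r delta : R) :
  0 < r -> 0 < delta <= 1 -> (forall x, A x -> `|x| <= r) ->
  (covering_number (@euclidean_dist R m) delta A <=
    (((2 * r * m%:R + 1) / delta) ^+ m)%:E)%E.
Proof.
move=> r0 /andP[delta0 delta1] Ar.
have m0 : 0 < m%:R :> R by rewrite ltr0n.
(* A cube of side [h] has Euclidean diameter at most [m * h = delta]; [delta <= 1] later absorbs the
   rounding in the number of cubes per axis. *)
pose h := delta / m%:R; have h0 : 0 < h by rewrite divr_gt0.
pose k := (Num.truncn (2 * r / h)).+1.
have rh0 : 0 <= 2 * r / h by rewrite divr_ge0 ?mulr_ge0// ltW.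
pose U (f : {ffun 'I_m -> 'I_k}) : set 'rV[R]_m :=
  [set x | forall i, (f i)%:R * h <= x 0 i + r <= (f i).+1%:R * h].
apply: (@le_trans _ _ (#|{ffun 'I_m -> 'I_k}|%:R%:E)%E).
  apply: ereal_inf_lbound; exists #|{ffun 'I_m -> 'I_k}| => //.
  exists (fun i => U (enum_val i)); split.
    move=> i; apply: diam_le => x y Ux Uy.
    apply: le_trans (enorm_le_norm _) _; rewrite -ler_pdivlMl// mulrC -/h.
    apply/rv_norm_leP; first exact: ltW.
    move=> j; rewrite !mxE; have := Ux j; have := Uy j.
    rewrite -natr1 mulrDl mul1r ler_norml; lra.
  move=> x Ax.
  have xP i : 0 <= (x 0 i + r) / h <= 2 * r / h.
    have := le_trans (rv_coord_le x i) (Ar _ Ax); rewrite ler_norml => /andP[x1 x2].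
    by rewrite divr_ge0 ?(ltW h0) ?ler_wpM2r ?invr_ge0 ?(ltW h0)//=; lra.
  have fk (i : 'I_m) : (Num.truncn ((x 0%R i + r)%R / h)%R < k)%N.
    by rewrite ltnS le_truncn//; have /andP[] := xP i.
  exists (enum_rank [ffun i => Ordinal (fk i)]) => // i.
  rewrite enum_rankK ffunE /=; have /andP[x0 _] := xP i.
  have /andP[t1 t2] := truncn_itv x0.
  by rewrite -ler_pdivlMr// t1/= -ler_pdivrMr// ltW.
rewrite lee_fin card_ffun !card_ord natrX lerXn2r ?nnegrE ?ler0n//.
  by rewrite divr_ge0 ?(ltW delta0)// addr_ge0// !mulr_ge0// ltW.
rewrite ler_pdivlMr// /k -natr1.
have /andP[t1 _] := truncn_itv rh0.
apply: (@le_trans _ _ ((2 * r / h + 1) * delta)); first by rewrite ler_wpM2r ?lerD2r// ltW.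
have -> : 2 * r / h = 2 * r * m%:R / delta.
  by rewrite /h; field; rewrite !gt_eqF.
by rewrite mulrDl mul1r divfK ?gt_eqF// lerD2l.
Qed.

Lemma upper_box_dim_le (A : set 'rV[R]_m) (r : R) : 0 < r ->
  (forall x, A x -> `|x| <= r) ->
  (upper_box_dim (@euclidean_dist R m) A <= m%:R%:E)%E.
Proof.
move=> r0 Ar; apply/lee_addgt0Pr => e e0.
pose C := 2 * r * m%:R + 1.
have C1 : 1 <= C by rewrite /C lerDr !mulr_ge0// ltW.
have C0 : 0 < C by lra.
have lnC0 : 0 <= ln C by exact: ln_ge0.
(* Below this threshold [m * ln C] is at most [e * (- ln delta)], so the constant [C] costs at most
   [e] in the quotient. *)
pose delta0 := Num.min 1 (expR (- (m%:R * ln C / e))).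
apply: ge_ereal_inf.
exists (ereal_sup [set (lne (covering_number (@euclidean_dist R m) delta A)
    * ((- ln delta)^-1)%:E)%E | delta in [set delta | 0 < delta < delta0]]).
  exists [set delta | 0 < delta < delta0] => //.
  have d00 : 0 < delta0 by rewrite lt_min ltr01 expR_gt0.
  apply: (filterS2 _ _ (nbhs_right_gt (0 : R)) (nbhs_right_lt d00)).
  by move=> delta dpos dlt; apply/andP.
apply: ge_ereal_sup => x [delta /andP[dpos]]; rewrite lt_min => /andP[d1 dexp] <-{x}.
have L0 : 0 < - ln delta by rewrite oppr_gt0 ln_lt0// dpos.
have CL : m%:R * ln C <= e * (- ln delta).
  rewrite -ler_pdivrMl// mulrC lerNr.
  by rewrite -[leRHS]expRK ler_ln ?posrE ?expR_gt0// ltW.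
have p0 : 0 < (C / delta) ^+ m by rewrite exprn_gt0// divr_gt0.
apply: (@le_trans _ _ ((lne ((C / delta) ^+ m)%:E) * ((- ln delta)^-1)%:E)%E).
  apply: lee_wpmul2r; first by rewrite lee_fin invr_ge0 ltW.
  rewrite lee_lne ?in_itv/= ?leey ?andbT ?covering_number_ge0 ?lee_fin ?(ltW p0)//.
  by apply: covering_number_le => //; rewrite dpos ltW.
rewrite lne_EFin// -EFinM lnXn ?divr_gt0// ln_div ?posrE// -[(_ - _) *+ _]mulr_natl.
rewrite -EFinD lee_fin ler_pdivrMr// mulrBr mulrDl; lra.
Qed.

Lemma upper_minkowski_dim_le (B : set 'rV[R]_m) :
  (upper_minkowski_dim (@euclidean_dist R m) B <= m%:R%:E)%E.
Proof.
apply: ge_ereal_sup => _ [A [AB dA] <-].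
have [A0|/set0P[x0 Ax0]] := eqVneq A set0.
  by apply: (@upper_box_dim_le _ 1) => // x; rewrite A0.
have [D DA] : exists D : R, forall x y, A x -> A y -> euclidean_dist x y <= D.
  have := le_diam (@euclidean_dist R m) Ax0 Ax0.
  case E : (diam _ _) dA => [D| |] // _ _; exists D => x y Ax Ay.
  by rewrite -lee_fin -E; exact: le_diam.
apply: (@upper_box_dim_le _ (`|D| + `|x0| + 1)) => [|x Ax].
  by rewrite ltr_wpDl.
rewrite -[x](subrK x0); apply: le_trans (ler_normD _ _) _.
have h : `|x - x0| <= D by apply: le_trans (norm_le_enorm _) _; exact: DA.
by have := ler_norm D; lra.
Qed.

Lemma besicovitch_upper_minkowski (B : set 'rV[R]_m) : (0 < n)%N ->
  (forall l : nat, (0 < l)%N -> fubini_for_lines R l) -> besicovitch B ->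
  upper_minkowski_dim (@euclidean_dist R m) B = m%:R%:E.
Proof.
move=> n0 F bB; apply/eqP; rewrite eq_le upper_minkowski_dim_le leNgt.
apply/negP => BD.
have [D [BD' D0 Dm]] : exists D : R,
    [/\ (upper_minkowski_dim (@euclidean_dist R m) B < D%:E)%E, 0 < D & D < m%:R].
  move: BD; case: (upper_minkowski_dim _ _) => [u| |]//.
    rewrite lte_fin => um; exists ((Num.max u 0 + m%:R) / 2).
    have u0 : u <= Num.max u 0 by rewrite le_max lexx.
    have u1 : 0 <= Num.max u 0 by rewrite le_max lexx orbT.
    have um' : Num.max u 0 < m%:R by rewrite gt_max um ltr0n.
    split; [rewrite lte_fin| |]; lra.
  by move=> _; exists (m%:R / 2); have : 0 < m%:R :> R by []; split; [exact: ltNyr|lra|lra].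
(* [k.+1 * (m - D) > 1] puts [k.+1 * D] below [k.+1 * m - 1], the lower bound for the Hausdorff
   dimension of the power; [s] is the midpoint of the two. *)
pose k := Num.truncn (m%:R - D)^-1.
have kP : 1 < k.+1%:R * (m%:R - D).
  by rewrite -ltr_pdivrMr ?subr_gt0// div1r truncnS_gt.
pose s := (k.+1%:R * D + (k.+1%:R * m%:R - 1)) / 2.
have kD0 : 0 < k.+1%:R * D by rewrite mulr_gt0.
have s0 : 0 < s by rewrite /s; lra.
have Ds : k.+1%:R * D < s by rewrite /s; lra.
have nP := null_cover_power s0 Ds BD'.
(* [(n + k * n.+1).+1] computes to [k.+1 * n.+1], so the dimension bound applies to the power
   directly. *)
have := besicovitch_dim_ge (n := n + k * n.+1) _ (F _ _) (besicovitch_power (k := k) bB).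
rewrite addn_gt0 n0 => /(_ isT isT); apply/negP; rewrite -ltNge.
have nP' : null_cover (@euclidean_dist R (k.+1 * m)) s (power_set (k := k) B).
  exact/null_cover_euclidean.
apply: (@le_lt_trans _ _ s%:E).
  by apply: hausdorff_dim_le_null_cover => //; exact: euclidean_dist_ge0.
rewrite lte_fin (_ : (n + k * n.+1).+1 = (k.+1 * n.+1)%N)// natrM.
by rewrite /s; lra.
Qed.

End box_dimension.

(* The dimension m >= 2 of the ambient space is n.+1 with 1 <= n. *)
Theorem theorem3p12 (R : realType) :
  (forall n : nat, (1 <= n)%N -> fubini_for_lines R n ->
     forall B : set 'rV[R]_n.+1, besicovitch B ->
       ((n.+1%:R - 1)%:E <= hausdorff_dim (@euclidean_dist R n.+1) B)%E)
  /\
  ((forall n : nat, (1 <= n)%N -> fubini_for_lines R n) ->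
     forall n : nat, (1 <= n)%N ->
     forall B : set 'rV[R]_n.+1, besicovitch B ->
       upper_minkowski_dim (@euclidean_dist R n.+1) B = (n.+1%:R)%:E).
Proof.
split; first by move=> n n0 Fn B bB; exact: besicovitch_dim_ge.
by move=> F n n0 B bB; exact: besicovitch_upper_minkowski.
Qed.
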